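(* Let $X_1,\dots,X_n$ be the Hall–Grayson–Grossman vector fields on $\mathbb{R}^n$ (realizing the free nilpotent Lie group $G=\mathbb{R}^n$ of rank $r\ge2$ and step $s\ge2$) with structure constants $c_{ij}^k$, let $\gamma:[0,1]\to\mathbb{R}^n$ be a horizontal curve with $\gamma(0)=0$, and let $\lambda:[0,1]\to\mathbb{R}^n$ be a Lipschitz curve. The following are equivalent: (A) for every $i=1,\dots,n$, $\dot\lambda_i=-\sum_{k=1}^n\sum_{j=1}^rc_{ij}^k\dot\gamma_j\lambda_k$ a.e. on $[0,1]$; (B) there exists $v\in\mathbb{R}^n$ such that $\lambda_i(t)=P^v_i(\gamma(t))$ for all $t\in[0,1]$ and all $i=1,\dots,n$; and in fact $v=\lambda(0)$.
   Context: Multi-indices: $\mathcal I=\mathbb{N}^n$; $|\alpha|=\sum\alpha_i$, $\alpha!=\prod\alpha_i!$, $x^\alpha=\prod x_i^{\alpha_i}$. Hall basis. Let $\mathfrak g=\mathfrak g_1\oplus\cdots\oplus\mathfrak g_s$ be the free nilpotent real Lie algebra of rank $r$ and step $s$, dimension $n$. Take a basis $X_1,\dots,X_r$ of $\mathfrak g_1$ (degree 1). Inductively, the basis elements of degree $d$ are the brackets $[X_i,X_j]$ of previously constructed elements with $i>j$, $d(i)+d(j)=d$, and such that, if $X_i$ was constructed as $[X_h,X_k]$, then $k\le j$; they are appended after those of lower degree. This gives a basis $X_1,\dots,X_n$. To each index $\ell$ attach a string: $(\ell)$ if $\ell\le r$; if $X_\ell=[X_a,X_b]$ was so constructed, the string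 of $a$ followed by $b$. With string $(\ell_0,\dots,\ell_h)$ one has $X_\ell=[\cdots[X_{\ell_0},X_{\ell_1}],\dots,X_{\ell_h}]$; set $I(\ell)_j=\#\{1\le p\le h:\ell_p=j\}$; write $j\prec\ell$ if the string of $j$ is an initial segment of that of $\ell$. For $\alpha\in\mathcal I$, $[Y,X_\alpha]$ is the left-nested bracket of $Y$ successively with $X_1$ ($\alpha_1$ times), $X_2$ ($\alpha_2$ times), ..., $X_n$ ($\alpha_n$ times); $[Y,X_0]=Y$. Realization: on $\mathbb{R}^n$ set $X_i=\sum_{\ell:\,i\prec\ell}\frac{(-1)^{|I(\ell)|}}{I(\ell)!}x^{I(\ell)}\partial_{x_\ell}$ for $i\le r$, and $X_\ell=[X_a,X_b]$ (vector field bracket) for $\ell>r$ constructed as $[X_a,X_b]$. These form a frame and a basis of a Lie algebra isomorphic to $\mathfrak g$; $[X_i,X_j]=\sum_kc_{ij}^kX_k$ with constants $c^k_{ij}$. Generalized structure constants: $[X_i,X_\alpha]=\sum_kc^k_{i\alpha}X_k$. Extremal polynomials: $P^v_i(x)=\sum_{\alpha\in\mathcal I}\frac{(-1)^{|\alpha|}}{\alpha!}\big(\sum_{k=1}^nc^k_{i\alpha}v_k\big)x^\alpha$ for $v\in\mathbb{R}^n$. A Lipschitz $\gamma:[0,1]\to\mathbb{R}^n$ is horizontal if $\dot\gamma=\sum_{j=1}^rh_jX_j(\gamma)$ a.e. for some $h\in L^\infty([0,1];\mathbb{R}^r)$; here $h_j=\dot\gamma_j$. *)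

(* Defs.v *)
From HB Require Import structures.
From mathcomp Require Import all_boot all_order all_algebra.
From mathcomp Require Import all_classical all_reals all_analysis.
Unset Implicit Arguments.

Unset Printing Implicit Defensive.
Import Order.TTheory GRing.Theory Num.Theory.
Import numFieldNormedType.Exports.
Local Open Scope classical_set_scope.
Local Open Scope ring_scope.

(* Hall basis (combinatorics).  Indices are 0-based: the paper's index *)
(* l (1 <= l <= n) is our l-1; generators are 0 .. r-1.               *)
(* An entry is (degree, None) for a generator, (degree, Some (a,b))   *)
(* for an element constructed as [X_a, X_b].                          *)
Definition hentry := (nat * option (nat * nat))%type.

Definition hnth (B : seq hentry) (i : nat) : hentry := nth (0%N, None) B i.
Definition hdeg (B : seq hentry) (i : nat) : nat := (hnth B i).1.

Definition hall_ok (B : seq hentry) (d : nat) (ij : nat * nat) : bool :=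
  [&& (ij.2 < ij.1)%N, (hdeg B ij.1 + hdeg B ij.2 == d)%N &
      match (hnth B ij.1).2 with
      | None => true
      | Some hk => (hk.2 <= ij.2)%N
      end].

Definition hall_new (B : seq hentry) (d : nat) : seq hentry :=
  map (fun ij => (d, Some ij))
    (seq.filter (hall_ok B d)
       (allpairs pair (iota 0 (size B)) (iota 0 (size B)))).

Fixpoint hall (r d : nat) : seq hentry :=
  match d with
  | 0 => [::]
  | 1 => nseq r (1%N, None)
  | d'.+1 => let B := hall r d' in B ++ hall_new B d
  end.

Definition hdim (r s : nat) : nat := size (hall r s).

(* string of an index: (l) for a generator, string(a) followed by b
   if X_l = [X_a, X_b] (fuel-based recursion; a < l) *)
Fixpoint hstr_aux (B : seq hentry) (fuel l : nat) : seq nat :=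
  match fuel with
  | 0 => [::]
  | f.+1 => match (hnth B l).2 with
            | None => [:: l]
            | Some ab => rcons (hstr_aux B f ab.1) ab.2
            end
  end.
Definition hstr (r s l : nat) : seq nat := hstr_aux (hall r s) l.+1 l.

Definition hI (r s l j : nat) : nat := count_mem j (behead (hstr r s l)).

Section VF.
Variable R : realType.

Definition vfield (n : nat) := 'rV[R]_n -> 'rV[R]_n.

Definition pdiff {n : nat} (f : 'rV[R]_n -> R) (m : 'I_n) (x : 'rV[R]_n) : R :=
  'D_(delta_mx 0 m) f x.

Definition lie {n : nat} (V W : vfield n) : vfield n := fun x =>
  \row_(k < n) \sum_(m < n)
     (V x 0 m * pdiff (fun y => W y 0 k) m x
      - W x 0 m * pdiff (fun y => V y 0 k) m x).

Definition genX (r s : nat) (i : nat) : vfield (hdim r s) := fun x =>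
  \row_(l < hdim r s)
    (if prefix [:: i] (hstr r s l) then
       ((-1) ^+ (size (behead (hstr r s l)))
         / (\prod_(j < hdim r s) (hI r s l j)`!)%:R)
       * \prod_(j < hdim r s) x 0 j ^+ hI r s l j
     else 0).

Fixpoint hX_aux (r s fuel l : nat) : vfield (hdim r s) :=
  match fuel with
  | 0 => fun _ => 0
  | f.+1 => match (hnth (hall r s) l).2 with
            | None => genX r s l
            | Some ab => lie (hX_aux r s f ab.1) (hX_aux r s f ab.2)
            end
  end.

Definition hX (r s : nat) (l : 'I_(hdim r s)) : vfield (hdim r s) :=
  hX_aux r s l.+1 l.

Definition brX (r s : nat) (Y : vfield (hdim r s))
    (alpha : 'I_(hdim r s) -> nat) : vfield (hdim r s) :=
  foldl (fun Z j => iter (alpha j) (fun W => lie W (hX r s j)) Z)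
        Y (enum 'I_(hdim r s)).

(* extremal polynomials
   P^v_i(x) = sum_alpha (-1)^|alpha|/alpha! (sum_k c^k_{i alpha} v_k) x^alpha,
   the sum being over alpha with all alpha_j <= s (all other terms vanish
   since [X_i, X_alpha] = 0 as soon as |alpha| >= s) *)
Definition extremalP (r s : nat)
    (cg : 'I_(hdim r s) -> ('I_(hdim r s) -> nat) -> 'I_(hdim r s) -> R)
    (v : 'rV[R]_(hdim r s)) (i : 'I_(hdim r s)) (x : 'rV[R]_(hdim r s)) : R :=
  \sum_(alpha : {ffun 'I_(hdim r s) -> 'I_s.+1})
    ((-1) ^+ (\sum_(j < hdim r s) alpha j)
      / (\prod_(j < hdim r s) (alpha j)`!)%:R
     * (\sum_(k < hdim r s) cg i (fun j => nat_of_ord (alpha j)) k * v 0 k)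
     * \prod_(j < hdim r s) x 0 j ^+ alpha j).

Definition lipschitz01 {n : nat} (f : R -> 'rV[R]_n) : Prop :=
  exists L : R, forall t u : R, 0 <= t <= 1 -> 0 <= u <= 1 ->
    `|f t - f u| <= L * `|t - u|.

Definition horizontal (r s : nat) (g : R -> 'rV[R]_(hdim r s)) : Prop :=
  lipschitz01 g /\
  exists h : 'I_(hdim r s) -> R -> R,
    (forall j : 'I_(hdim r s), (j < r)%N ->
       measurable_fun (`[0%R, 1%R] : set R) (h j) /\
       exists M : R, {ae (@lebesgue_measure R), forall t : R,
                        0 <= t <= 1 -> `|h j t| <= M}) /\
    {ae (@lebesgue_measure R), forall t : R, 0 <= t <= 1 ->
       derivable g t 1 /\
       'D_1 g t = \sum_(j < hdim r s | (j < r)%N) h j t *: hX r s j (g t)}.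

End VF.

Arguments vfield {R} n.
Arguments pdiff {R n} f m x.
Arguments lie {R n} V W x.
Arguments genX {R} r s i x.
Arguments hX_aux {R} r s fuel l x.
Arguments hX {R} r s l x.
Arguments brX {R} r s Y alpha x.
Arguments extremalP {R} r s cg v i x.
Arguments lipschitz01 {R n} f.
Arguments horizontal {R} r s g.

(* Main.v *)
(* Let A_m be the matrix of the bracket with X_m in the basis X_0, ..., X_(n-1), acting on row
   vectors.  Then P^v_i(x) is the i-th entry of E_0 ... E_(n-1) v with E_m = exp(- x_m A_m),
   i.e. of Ad(exp(x_(n-1) X_(n-1)) ... exp(x_0 X_0)).  For a generator X_j, applying the factors
   exp(x_m ad X_m) successively to X_j only produces brackets that are again Hall elements, with
   precisely the monomials of the realization as coefficients.  Since each E_m is an automorphism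
   of the Lie algebra, this gives X_j P = - A_j P along the realized field X_j, so
   t |-> P(gamma t) v solves the linear equation (A).  Conversely, if lambda solves (A), then
   P(gamma t)^-1 lambda(t) is Lipschitz with derivative zero almost everywhere, hence constant.
   The coefficients c and cg are determined by the fields because X_l(0) is the l-th basis vector. *)

Require Import Defs.
From HB Require Import structures.
From mathcomp Require Import all_boot all_order all_algebra.
From mathcomp Require Import all_classical all_reals all_analysis.
From mathcomp Require Import measurable_realfun zify ring lra.
Import Order.TTheory GRing.Theory Num.Theory.
Import numFieldNormedType.Exports.
Local Open Scope classical_set_scope.
Local Open Scope ring_scope.

(** * Hall basis and strings *)

(** A bracket field has no manageable closed form on all of $\mathbb{R}^n$: for $X_l=[X_a,X_b]$ the
    monomial shape survives only where the coordinates before $b$ vanish. This suffices at the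
    origin, where every identity between constant combinations of the fields can be read off.
    Finiteness has another source: the fields are homogeneous under weighted dilations, so
    $c_{ij}^k\ne0$ forces $\deg k=\deg i+\deg j$; hence each $A_m$ is nilpotent and its exponential
    is a finite sum. That these exponentials are automorphisms rests on the Jacobi identity, proved
    for polynomial fields and transferred to the constants at the origin. The Hall condition enters
    twice: it sorts the letters of a string, so that the factors can be applied in increasing order,
    and it makes $[X_a,X_k]$ a basis element (or zero, beyond step $s$) when $k<a$ and the string of
    $a$ has only letters at most $k$ after its first one. *)

Record hall_spec (r d : nat) (B : seq hentry) : Prop := HallSpec {
  hall_gen : forall i, (i < r)%N -> (i < size B)%N /\ hnth B i = (1%N, None);
  hall_none : forall i, (i < size B)%N -> (hnth B i).2 = None -> (i < r)%N;
  hall_some : forall i a b, (hnth B i).2 = Some (a, b) ->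
    [/\ (b < a)%N, (a < i)%N, (i < size B)%N,
        hdeg B i = (hdeg B a + hdeg B b)%N &
        forall h k, (hnth B a).2 = Some (h, k) -> (k <= b)%N];
  hall_deg : forall i, (i < size B)%N -> (1 <= hdeg B i <= d)%N;
  hall_inj : forall i j ab, (hnth B i).2 = Some ab ->
    (hnth B j).2 = Some ab -> i = j;
  hall_ex : forall a b, (a < size B)%N -> (b < a)%N ->
    (hdeg B a + hdeg B b <= d)%N ->
    (forall h k, (hnth B a).2 = Some (h, k) -> (k <= b)%N) ->
    exists i, (hnth B i).2 = Some (a, b) }.

Lemma hnth_default B i : (size B <= i)%N -> hnth B i = (0%N, None).
Proof. exact: nth_default. Qed.

Lemma hall_spec1 r : hall_spec r 1 (hall r 1).
Proof.
have szr : size (hall r 1) = r by rewrite size_nseq.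
have nr i : (i < r)%N -> hnth (hall r 1) i = (1%N, None).
  by move=> ir; rewrite /hnth nth_nseq ir.
have nN i : (hnth (hall r 1) i).2 = None.
  by rewrite /hnth nth_nseq; case: ifP.
split; rewrite ?szr.
- by move=> i ir; split=> //; exact: nr.
- by [].
- by move=> i a b; rewrite nN.
- by move=> i ir; rewrite /hdeg nr.
- by move=> i j ab; rewrite nN.
- move=> a b ar ba; rewrite /hdeg !nr //; exact: ltn_trans ba ar.
Qed.

(** Old entries have degrees between 1 and d, appended ones degree d+1. So both factors of a bracket
    of degree at most d+1 are old, an old and a new entry never carry the same pair, and a new pair
    occurs once since the list of pairs is duplicate-free. *)
Lemma hall_new_step r d B : hall_spec r d B -> (0 < d)%N ->
  hall_spec r d.+1 (B ++ hall_new B d.+1).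
Proof.
move=> [gen none some deg inj ex] d0.
pose L := seq.filter (hall_ok B d.+1)
  (allpairs pair (iota 0 (size B)) (iota 0 (size B))).
pose B' := B ++ hall_new B d.+1.
have uL : uniq L.
  by apply: filter_uniq; apply: allpairs_uniq; rewrite ?iota_uniq // => -[? ?] [].
have memL a b : ((a, b) \in L) =
    [&& (a < size B)%N, (b < size B)%N & hall_ok B d.+1 (a, b)].
  rewrite mem_filter andbC.
  have -> : ((a, b) \in allpairs pair (iota 0 (size B)) (iota 0 (size B))) =
    (a \in iota 0 (size B)) && (b \in iota 0 (size B)).
    apply/allpairsP/andP => [[[x y] /= [? ? [-> ->]]]//|[? ?]].
    by exists (a, b).
  by rewrite !mem_iota !add0n /= andbA.
have szB' : size B' = (size B + size L)%N by rewrite size_cat size_map.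
have sB : (size B <= size B')%N by rewrite szB' leq_addr.
have old i : (i < size B)%N -> hnth B' i = hnth B i.
  by move=> iB; rewrite /hnth nth_cat iB.
have new i : (size B <= i < size B')%N ->
    hnth B' i = (d.+1, Some (nth (0, 0)%N L (i - size B))) /\
    nth (0, 0)%N L (i - size B) \in L.
  move=> /andP[Bi iB'].
  have iL : (i - size B < size L)%N by rewrite ltn_subLR // -szB'.
  split; last exact: mem_nth.
  by rewrite /hnth nth_cat ltnNge Bi /= (nth_map (0, 0)%N).
have someB i a b : (hnth B i).2 = Some (a, b) -> (i < size B)%N.
  by case/some.
have degB i : (i < size B)%N -> hdeg B' i = hdeg B i.
  by move=> iB; rewrite /hdeg old.
have case_i i : (hnth B' i).2 <> None -> (i < size B)%N \/ (size B <= i < size B')%N.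
  move=> h; case: (ltnP i (size B)) => iB; first by left.
  case: (ltnP i (size B')) => iB'; first by right.
  by case: h; rewrite hnth_default.
have newS i a b : (size B <= i)%N -> (hnth B' i).2 = Some (a, b) ->
    [/\ (size B <= i < size B')%N, (a, b) = nth (0, 0)%N L (i - size B),
       hdeg B' i = d.+1 & (a, b) \in L].
  move=> Bi e; have /case_i : (hnth B' i).2 <> None by rewrite e.
  case=> [|iB']; first by rewrite ltnNge Bi.
  have [e1 e2] := new _ iB'; rewrite /hdeg; move: e; rewrite e1 /= => -[<-].
  by split.
split.
- move=> i /gen[iB e]; rewrite old // e; split=> //.
  by rewrite -/B' szB' ltn_addr.
- move=> i iB'; case: (ltnP i (size B)) => iB; first by rewrite old //; exact: none.
  have [|-> //] := new i; by rewrite iB.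
- move=> i a b; case: (ltnP i (size B)) => iB.
    rewrite old // => /some[ba ai _ e h].
    have aB := ltn_trans ai iB; have bB := ltn_trans ba aB.
    by rewrite !degB // old //; split=> //; exact: leq_trans iB sB.
  move/(newS _ _ _ iB) => [/andP[_ iB'] _ e]; rewrite memL => /and3P[aB bB].
  rewrite /hall_ok /= => /and3P[ba /eqP dab h].
  rewrite e !degB // old // dab; split => //; first exact: leq_trans aB _.
  by move=> ? ? hk; move: h; rewrite hk.
- move=> i iB'; case: (ltnP i (size B)) => iB.
    by rewrite degB // -/B'; have /andP[-> /leqW] := deg _ iB.
  by have [|e _] := new i; rewrite ?iB // /hdeg e /= leqnn.
- move=> i j [a b] ei ej.
  have h i' j' : (i' < size B)%N -> (size B <= j')%N ->
      (hnth B' i').2 = Some (a, b) -> (hnth B' j').2 = Some (a, b) -> False.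
    move=> iB Bj; rewrite old // => /some[ba ai _ e _].
    move/(newS _ _ _ Bj) => [_ _ _]; rewrite memL => /and3P[_ _].
    rewrite /hall_ok /= -e => /and3P[_ /eqP dd _].
    by have := deg _ iB; rewrite dd ltnn andbF.
  case: (ltnP i (size B)) (ltnP j (size B)) => [iB|Bi] [jB|Bj].
  + by move: ei ej; rewrite !old //; exact: inj.
  + by case: (h i j).
  + by case: (h j i).
  + have [/andP[_ iB'] e1 _ _] := newS _ _ _ Bi ei.
    have [/andP[_ jB'] e2 _ _] := newS _ _ _ Bj ej.
    have : (i - size B == j - size B)%N.
      by rewrite -(nth_uniq (0, 0)%N _ _ uL) -?e1 -?e2 // ltn_subLR // -szB'.
    by rewrite eqn_sub2rE // => /eqP.
- move=> a b aB' ba dab h.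
  have lowdeg i : (i < size B')%N -> (hdeg B' i <= d)%N -> (i < size B)%N.
    move=> iB'; case: (ltnP i (size B)) => // Bi.
    by have [|e _] := new i; rewrite ?Bi // /hdeg e /= ltnn.
  have degp i : (i < size B')%N -> (0 < hdeg B' i)%N.
    move=> iB'; case: (ltnP i (size B)) => Bi.
      by rewrite degB //; have /andP[] := deg _ Bi.
    by have [|e _] := new i; rewrite ?Bi // /hdeg e.
  have bB' := ltn_trans ba aB'.
  have aB : (a < size B)%N by apply: lowdeg => //; have := degp _ bB'; rewrite -/B' in dab; lia.
  have bB := ltn_trans ba aB.
  move: dab h; rewrite !degB // old // => dab h.
  case: (ltngtP (hdeg B a + hdeg B b) d.+1) dab => [dab _|//|dab _].
    have [i e] := ex _ _ aB ba dab h; exists i.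
    by rewrite old //; exact: someB e.
  have : (a, b) \in L.
    rewrite memL aB bB /hall_ok /= ba dab eqxx /=.
    by case: (hnth B a).2 h => // -[h' k'] /(_ _ _ erefl).
  move=> /[dup] mL; rewrite -index_mem => iL; exists (size B + index (a, b) L)%N.
  have [|-> _ /=] := new (size B + index (a, b) L)%N.
    by rewrite leq_addr szB' ltn_add2l.
  by rewrite addKn nth_index.
Qed.

Lemma hallP r s : (0 < s)%N -> hall_spec r s (hall r s).
Proof.
case: s => // s _; elim: s => [|s IH]; first exact: hall_spec1.
exact: hall_new_step.
Qed.

Section Strings.
Variables (r s : nat).
Hypothesis s_gt0 : (0 < s)%N.
Local Notation B := (hall r s).
Local Notation str := (hstr r s).
Let HS := hallP r s s_gt0.

(** Induction along the bracket tree. An index beyond the basis has the default entry, without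
    factors, and falls under the first case. *)
Lemma hall_indP (P : nat -> Prop) :
  (forall l, (hnth B l).2 = None -> P l) ->
  (forall l a b, (hnth B l).2 = Some (a, b) -> P a -> P b -> P l) ->
  forall l, P l.
Proof.
move=> Pgen Pbr; elim/ltn_ind => l IH.
case e : (hnth B l).2 => [[a b]|]; last exact: Pgen.
have [ba al _ _ _] := hall_some _ _ _ HS _ _ _ e.
by apply: (Pbr _ _ _ e); apply: IH => //; exact: ltn_trans al.
Qed.

Lemma hstr_aux_fuel f l : (l < f)%N -> hstr_aux B f l = str l.
Proof.
elim/ltn_ind: l f => l IH [//|f]; rewrite ltnS => lf.
rewrite /hstr /=; case e : (hnth B l).2 => [[a b]|//] /=.
have [_ al _ _ _] := hall_some _ _ _ HS _ _ _ e.
by rewrite !IH // (leq_trans al).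
Qed.

Lemma hstr_gen l : (hnth B l).2 = None -> str l = [:: l].
Proof. by move=> e; rewrite /hstr /= e. Qed.

Lemma hstr_node l a b : (hnth B l).2 = Some (a, b) -> str l = rcons (str a) b.
Proof.
move=> e; have [_ al _ _ _] := hall_some _ _ _ HS _ _ _ e.
by rewrite [LHS]/hstr /= e /= hstr_aux_fuel.
Qed.

Lemma hstr_cons l : exists j w, str l = j :: w.
Proof.
elim/hall_indP: l => [l /hstr_gen ->|l a b /hstr_node -> [j [w ->]] _].
  by exists l, [::].
by exists j, (rcons w b).
Qed.

Lemma behead_hstr_node l a b : (hnth B l).2 = Some (a, b) ->
  behead (str l) = rcons (behead (str a)) b.
Proof. by move=> /hstr_node ->; have [j [w ->]] := hstr_cons a. Qed.

(** A string of length at least two splits uniquely into the string of a and the last letter b, and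
    by [hall_inj] the pair (a, b) is bracketed only once. *)
Lemma hstr_inj l k : str l = str k -> l = k.
Proof.
elim/hall_indP: l k => [l e|l a b e IH _] k.
  rewrite (hstr_gen _ e); case ek : (hnth B k).2 => [[a' b']|].
    by rewrite (hstr_node _ _ _ ek); have [j [[|? ?] ->]] := hstr_cons a'.
  by rewrite (hstr_gen _ ek) => -[].
rewrite (hstr_node _ _ _ e); case ek : (hnth B k).2 => [[a' b']|].
  rewrite (hstr_node _ _ _ ek) => /eqP; rewrite eqseq_rcons => /andP[/eqP + /eqP bb].
  move/IH => aa; apply: (hall_inj _ _ _ HS _ _ _ e); by rewrite ek aa bb.
by rewrite (hstr_gen _ ek); have [j [[|? ?] ->]] := hstr_cons a.
Qed.

Lemma size_hstr l : (l < size B)%N -> (size (str l) <= hdeg B l)%N.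
Proof.
elim/hall_indP: l => [l e lB|l a b e IHa _ lB].
  by rewrite (hstr_gen _ e) /=; have /andP[] := hall_deg _ _ _ HS _ lB.
have [ba al _ -> _] := hall_some _ _ _ HS _ _ _ e.
rewrite (hstr_node _ _ _ e) size_rcons -addn1 leq_add ?IHa ?(ltn_trans al) //.
by have /andP[] := hall_deg _ _ _ HS b (ltn_trans ba (ltn_trans al lB)).
Qed.

(** The Hall condition k <= b on [[X_h, X_k], X_b] says precisely that the letters after the first
    are appended in nondecreasing order. *)
Lemma hstr_tail_le l a b : (hnth B l).2 = Some (a, b) ->
  all (fun q => (q <= b)%N) (behead (str l)) /\ sorted leq (behead (str l)).
Proof.
elim/hall_indP: l a b => [l -> //|l a' b' e IH _ a b].
rewrite e => -[_ <-]; rewrite (behead_hstr_node _ _ _ e).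
have [_ _ _ _ h] := hall_some _ _ _ HS _ _ _ e.
case ea : (hnth B a').2 => [[h' k']|]; last by rewrite (hstr_gen _ ea) /= leqnn.
have [le1 so] := IH _ _ ea; have kb := h _ _ ea.
have le2 : all (fun q => (q <= b')%N) (behead (str a')).
  by apply: sub_all le1 => q /leq_trans -> //.
split; first by rewrite all_rcons leqnn.
case: (behead (str a')) so le2 => //= q w so /andP[qb le2].
rewrite rcons_path so /=.
by have := mem_last q w; rewrite inE => /orP[/eqP -> //|/(allP le2)].
Qed.

Lemma hstr_tail_sorted l : sorted leq (behead (str l)).
Proof.
case e : (hnth B l).2 => [[a b]|]; first by case: (hstr_tail_le _ _ _ e).
by rewrite (hstr_gen _ e).
Qed.

Lemma hstr_tail_lt l : all (fun q => (q < l)%N) (behead (str l)).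
Proof.
case e : (hnth B l).2 => [[a b]|]; last by rewrite (hstr_gen _ e).
have [ba al _ _ _] := hall_some _ _ _ HS _ _ _ e.
have [h _] := hstr_tail_le _ _ _ e.
by apply: sub_all h => q qb; rewrite (leq_ltn_trans qb) // (ltn_trans ba).
Qed.

(** The first letter q added to the string of l comes from a Hall bracket [X_l, X_q], which requires
    q < l. *)
Lemma hstr_prefixP l k : prefix (str l) (str k) ->
  k = l \/ exists q w, [/\ str k = str l ++ q :: w, (q < l)%N & (l < k)%N].
Proof.
elim/hall_indP: k => [k e|k a b e IH _].
  rewrite (hstr_gen _ e) => /prefixP[w]; have [j [w' el]] := hstr_cons l.
  rewrite el => -[kj /esym/eqP]; rewrite -size_eq0 size_cat addn_eq0.
  move=> /andP[/eqP/size0nil w0 _]; left; apply: hstr_inj.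
  by rewrite (hstr_gen _ e) el kj w0.
have [ba ak _ _ _] := hall_some _ _ _ HS _ _ _ e.
have ek := hstr_node _ _ _ e; case/prefixP => w0; case: (lastP w0) => {w0} [|w0 x].
  by rewrite cats0 => /hstr_inj; left.
rewrite ek -rcons_cat => /rcons_inj[ea _].
have /IH[al|[q [w [{}ea ql la]]]] : prefix (str l) (str a).
  by apply/prefixP; exists w0.
  by right; exists b, [::]; rewrite -al cats1.
right; exists q, (rcons w b); split => //; last exact: ltn_trans ak.
by rewrite ea rcons_cat.
Qed.

Lemma hstr_prefix_sorted l k q w : str k = str l ++ q :: w -> sorted leq (q :: w).
Proof.
move=> e; have := hstr_tail_sorted k; rewrite e.
have [j [w' ->]] := hstr_cons l; rewrite /= => h.
by case/cat_sorted2 : (h : sorted leq (w' ++ (q :: w))).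
Qed.

End Strings.

(** * Polynomial vector fields *)

Section PolyFun.
Context {R : realType} {n : nat}.
Implicit Types (f g : 'rV[R]_n -> R) (x v : 'rV[R]_n) (U V W : @vfield R n).

(** Polynomials are described by how they are built, so that derivability, stability under partial
    derivatives and symmetry of second derivatives are all structural inductions. *)
Inductive polyfun : ('rV[R]_n -> R) -> Prop :=
| polyfun_cst a : polyfun (fun=> a)
| polyfun_coord i : polyfun (fun x => x 0 i)
| polyfunD f g : polyfun f -> polyfun g -> polyfun (fun x => f x + g x)
| polyfunM f g : polyfun f -> polyfun g -> polyfun (fun x => f x * g x).

Lemma polyfunN f : polyfun f -> polyfun (fun x => - f x).
Proof.
move=> pf; have -> : (fun x => - f x) = (fun x => (-1) * f x).
  by apply/funext => x; rewrite mulN1r.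
exact: polyfunM (polyfun_cst _) pf.
Qed.

Lemma polyfunB f g : polyfun f -> polyfun g -> polyfun (fun x => f x - g x).
Proof. by move=> pf pg; apply: polyfunD => //; exact: polyfunN. Qed.

Lemma polyfun_sum (I : Type) (r : seq I) (P : pred I) (F : I -> 'rV[R]_n -> R) :
  (forall i, polyfun (F i)) -> polyfun (fun x => \sum_(i <- r | P i) F i x).
Proof.
move=> pF; elim: r => [|i r IH].
  by under eq_fun do rewrite big_nil; exact: polyfun_cst.
under eq_fun do rewrite big_cons; case: (P i) => //; exact: polyfunD.
Qed.

Lemma polyfun_prod (I : Type) (r : seq I) (P : pred I) (F : I -> 'rV[R]_n -> R) :
  (forall i, polyfun (F i)) -> polyfun (fun x => \prod_(i <- r | P i) F i x).
Proof.
move=> pF; elim: r => [|i r IH].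
  by under eq_fun do rewrite big_nil; exact: polyfun_cst.
under eq_fun do rewrite big_cons; case: (P i) => //; exact: polyfunM.
Qed.

Lemma polyfunX f k : polyfun f -> polyfun (fun x => f x ^+ k).
Proof.
move=> pf; elim: k => [|k IH].
  by under eq_fun do rewrite expr0; exact: polyfun_cst.
by under eq_fun do rewrite exprS; exact: polyfunM.
Qed.

Lemma is_derive_coord i x v : is_derive x v (fun y : 'rV[R]_n => y 0 i) (v 0 i).
Proof.
have d : derivable (id : 'rV[R]_n -> 'rV[R]_n) x v by exact: derivable_id.
apply: DeriveDef; first exact: (derivable_mxP _ _ _).1 d 0 i.
by have /rowP/(_ i) := derive_mx d; rewrite derive_id mxE => ->.
Qed.

Lemma polyfun_derivable f x v : polyfun f -> derivable f x v.
Proof.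
elim=> [a|i|{}f g _ df _ dg|{}f g _ df _ dg].
- exact: derivable_cst.
- by have [] := is_derive_coord i x v.
- exact: (@derivableD _ _ _ f g x v df dg).
- exact: (@derivableM _ _ f g x v df dg).
Qed.

(* Locked, so that unification never unfolds [pdiff] down to the limit defining it. *)
Fact pderiv_key : unit. Proof. exact: tt. Qed.
Definition pderiv := locked_with pderiv_key (@pdiff R n).

Lemma pderivE : pderiv = @pdiff R n. Proof. exact: (unlock (locked_with_unlockable _ _)). Qed.

Lemma pderiv_cst a m x : pderiv (fun=> a) m x = 0.
Proof. by rewrite pderivE; exact: derive_cst. Qed.

Lemma pderiv_coord i m x : pderiv (fun y => y 0 i) m x = (i == m)%:R.
Proof.
rewrite pderivE /pdiff; have [_ ->] := is_derive_coord i x (delta_mx 0 m).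
by rewrite mxE eqxx.
Qed.

Lemma pderivD f g m x : polyfun f -> polyfun g ->
  pderiv (fun y => f y + g y) m x = pderiv f m x + pderiv g m x.
Proof. by move=> pf pg; rewrite pderivE /pdiff deriveD //; exact: polyfun_derivable. Qed.

Lemma pderivM f g m x : polyfun f -> polyfun g ->
  pderiv (fun y => f y * g y) m x = pderiv f m x * g x + f x * pderiv g m x.
Proof.
move=> pf pg; rewrite pderivE /pdiff deriveM; [|exact: polyfun_derivable..].
by rewrite addrC [X in X + _]mulrC.
Qed.

Lemma pderivN f m x : polyfun f -> pderiv (fun y => - f y) m x = - pderiv f m x.
Proof. by move=> pf; rewrite pderivE; apply: deriveN; exact: polyfun_derivable. Qed.

Lemma pderivB f g m x : polyfun f -> polyfun g ->
  pderiv (fun y => f y - g y) m x = pderiv f m x - pderiv g m x.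
Proof. by move=> pf pg; rewrite pderivE; apply: deriveB; exact: polyfun_derivable. Qed.

Lemma pderiv_sum (I : Type) (r : seq I) (P : pred I) (F : I -> 'rV[R]_n -> R) m x :
  (forall i, polyfun (F i)) ->
  pderiv (fun y => \sum_(i <- r | P i) F i y) m x = \sum_(i <- r | P i) pderiv (F i) m x.
Proof.
move=> pF; elim: r => [|i r IH].
  by rewrite big_nil; under [X in pderiv X]eq_fun do rewrite big_nil; exact: pderiv_cst.
rewrite big_cons; under [X in pderiv X]eq_fun do rewrite big_cons.
by case: (P i) => //; rewrite pderivD // ?IH //; exact: polyfun_sum.
Qed.

Lemma polyfun_pderiv f m : polyfun f -> polyfun (pderiv f m).
Proof.
elim=> [a|i|{}f g pf df pg dg|{}f g pf df pg dg].
- have -> : pderiv (fun=> a) m = fun=> 0 by apply/funext => x; exact: pderiv_cst.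
  exact: polyfun_cst.
- have -> : pderiv (fun x => x 0 i) m = fun=> (i == m)%:R.
    by apply/funext => x; exact: pderiv_coord.
  exact: polyfun_cst.
- rewrite (_ : pderiv _ m = fun x => pderiv f m x + pderiv g m x); last first.
    by apply/funext => x; exact: pderivD.
  exact: polyfunD.
- rewrite (_ : pderiv _ m = fun x => pderiv f m x * g x + f x * pderiv g m x).
    by apply: polyfunD; exact: polyfunM.
  by apply/funext => x; exact: pderivM.
Qed.

Lemma pderivC f m k x : polyfun f -> pderiv (pderiv f m) k x = pderiv (pderiv f k) m x.
Proof.
have pd h p : polyfun h -> polyfun (pderiv h p) by exact: polyfun_pderiv.
move=> pf; elim: pf x => [a|i|{}f g pf ef pg eg|{}f g pf ef pg eg] x.
- have e p : pderiv (fun _ : 'rV[R]_n => a) p = fun=> 0 by apply/funext => y; exact: pderiv_cst.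
  by rewrite (e m) (e k) (pderiv_cst _ m) (pderiv_cst _ k).
- have e p : pderiv (fun y : 'rV[R]_n => y 0 i) p = fun=> (i == p)%:R.
    by apply/funext => y; exact: pderiv_coord.
  by rewrite (e m) (e k) (pderiv_cst _ m) (pderiv_cst _ k).
- have e p : pderiv (fun y => f y + g y) p = fun y => pderiv f p y + pderiv g p y.
    by apply/funext => y; exact: pderivD.
  have e2 p q : pderiv (fun y => pderiv f p y + pderiv g p y) q x =
      pderiv (pderiv f p) q x + pderiv (pderiv g p) q x.
    by apply: (pderivD (pderiv f p) (pderiv g p)); exact: pd.
  by rewrite (e m) (e k) (e2 m k) (e2 k m) ef eg.
- have e p : pderiv (fun y => f y * g y) p =
      fun y => pderiv f p y * g y + f y * pderiv g p y.
    by apply/funext => y; exact: pderivM.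
  have e2 p q : pderiv (fun y => pderiv f p y * g y + f y * pderiv g p y) q x =
      (pderiv (pderiv f p) q x * g x + pderiv f p x * pderiv g q x) +
      (pderiv f q x * pderiv g p x + f x * pderiv (pderiv g p) q x).
    rewrite (pderivD (fun y => pderiv f p y * g y) (fun y => f y * pderiv g p y)).
    - by rewrite (pderivM (pderiv f p) g) ?(pderivM f (pderiv g p)); auto.
    - by apply: polyfunM; auto.
    - by apply: polyfunM; auto.
  rewrite (e m) (e k) (e2 m k) (e2 k m) ef eg; ring.
Qed.

Definition vderive V f x : R := \sum_(m < n) V x 0 m * pderiv f m x.

Definition polyvf V := forall k, polyfun (fun x => V x 0 k).

Lemma lieE V W x k :
  lie V W x 0 k = vderive V (fun y => W y 0 k) x - vderive W (fun y => V y 0 k) x.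
Proof. by rewrite mxE sumrB /vderive pderivE. Qed.

Lemma polyfun_vderive V f : polyvf V -> polyfun f -> polyfun (vderive V f).
Proof.
move=> pV pf; apply: polyfun_sum => m; apply: polyfunM => //.
exact: polyfun_pderiv.
Qed.

Lemma polyvf_lie V W : polyvf V -> polyvf W -> polyvf (lie V W).
Proof.
move=> pV pW k; under eq_fun do rewrite lieE.
by apply: polyfunB; exact: polyfun_vderive.
Qed.

Lemma vderiveB V f g x : polyfun f -> polyfun g ->
  vderive V (fun y => f y - g y) x = vderive V f x - vderive V g x.
Proof.
move=> pf pg; rewrite /vderive -sumrB; apply: eq_bigr => m _.
by rewrite pderivB // mulrBr.
Qed.

(** The product rule splits U(Vf) into first-order terms, which make up the bracket, and
    second-order terms, which are symmetric in U and V by [pderivC] and cancel. *)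
Lemma vderive_lie U V f x : polyvf U -> polyvf V -> polyfun f ->
  vderive (lie U V) f x = vderive U (vderive V f) x - vderive V (vderive U f) x.
Proof.
move=> pU pV pf.
have E Y Z : polyvf Z -> vderive Y (vderive Z f) x =
    \sum_(k < n) vderive Y (fun y => Z y 0 k) x * pderiv f k x +
    \sum_(k < n) \sum_(m < n) Y x 0 m * Z x 0 k * pderiv (pderiv f k) m x.
  move=> pZ; rewrite -big_split /= /vderive.
  transitivity (\sum_(m < n) \sum_(k < n) Y x 0 m *
     (pderiv (fun y => Z y 0 k) m x * pderiv f k x + Z x 0 k * pderiv (pderiv f k) m x)).
    apply: eq_bigr => m _; rewrite pderiv_sum; last first.
      by move=> k; apply: polyfunM => //; exact: polyfun_pderiv.
    rewrite mulr_sumr; apply: eq_bigr => k _; rewrite pderivM //.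
    exact: polyfun_pderiv.
  rewrite exchange_big; apply: eq_bigr => k _ /=.
  rewrite mulr_suml -big_split; apply: eq_bigr => m _ /=.
  by rewrite mulrDr !mulrA.
rewrite !E // opprD addrACA -sumrB.
have -> : \sum_(k < n) \sum_(m < n) V x 0 m * U x 0 k * pderiv (pderiv f k) m x =
    \sum_(k < n) \sum_(m < n) U x 0 m * V x 0 k * pderiv (pderiv f k) m x.
  rewrite exchange_big; apply: eq_bigr => k _; apply: eq_bigr => m _ /=.
  by rewrite pderivC // [V x 0 k * _]mulrC.
rewrite subrr addr0; apply: eq_bigr => k _.
by rewrite lieE mulrBl.
Qed.

(** By [vderive_lie] both sides become the same alternating sum of iterated derivations. In this
    form the identity says that bracketing on the right with W is a derivation. *)
Lemma lie_jacobi U V W x : polyvf U -> polyvf V -> polyvf W ->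
  lie (lie U V) W x = lie (lie U W) V x + lie U (lie V W) x.
Proof.
move=> pU pV pW; apply/rowP => k.
have E Y Z (T : @vfield R n) : polyvf Y -> polyvf Z ->
   vderive T (fun y => lie Y Z y 0 k) x =
   vderive T (vderive Y (fun y => Z y 0 k)) x - vderive T (vderive Z (fun y => Y y 0 k)) x.
  move=> pY pZ; rewrite -vderiveB; [|exact: polyfun_vderive..].
  by congr vderive; apply/funext => y; rewrite lieE.
rewrite [RHS]mxE !lieE !E // !vderive_lie //; ring.
Qed.

Lemma lieC V W x : lie V W x = - lie W V x.
Proof. by apply/rowP => k; rewrite [RHS]mxE !lieE opprB. Qed.

Lemma lie_suml (I : finType) (a : I -> R) (X : I -> vfield n) W x :
  (forall i, polyvf (X i)) ->
  lie (fun y => \sum_i a i *: X i y) W x = \sum_i a i *: lie (X i) W x.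
Proof.
move=> pX; apply/rowP => k; rewrite summxE lieE /vderive.
have -> : (fun y => (\sum_i a i *: X i y) 0 k) = fun y => \sum_i a i * X i y 0 k.
  by apply/funext => y; rewrite summxE; apply: eq_bigr => i _; rewrite mxE.
transitivity (\sum_i \sum_(m < n)
   a i * (X i x 0 m * pderiv (fun y => W y 0 k) m x
    - W x 0 m * pderiv (fun y => X i y 0 k) m x)).
  rewrite exchange_big -sumrB; apply: eq_bigr => m _ /=.
  rewrite summxE pderiv_sum; last first.
    by move=> i; apply: (polyfunM (fun=> a i)); [exact: polyfun_cst|exact: pX].
  rewrite mulr_suml mulr_sumr -sumrB; apply: eq_bigr => i _.
  rewrite mxE (pderivM _ _ _ _ (polyfun_cst _) (pX i k)) pderiv_cst; ring.
by apply: eq_bigr => i _; rewrite !mxE mulr_sumr pderivE.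
Qed.

Lemma lie_sumr (I : finType) (a : I -> R) (X : I -> vfield n) W x :
  (forall i, polyvf (X i)) ->
  lie W (fun y => \sum_i a i *: X i y) x = \sum_i a i *: lie W (X i) x.
Proof.
move=> pX; rewrite lieC lie_suml // -sumrN; apply: eq_bigr => i _.
by rewrite lieC scalerN opprK.
Qed.

(** * Weighted dilations and homogeneous fields *)

Section Homogeneity.
Variables (a : R) (w : 'I_n -> nat).
Hypothesis a_neq0 : a != 0.

Definition dilation x : 'rV[R]_n := \row_i (a ^+ w i * x 0 i).

Lemma polyfun_dilation f : polyfun f -> polyfun (fun x => f (dilation x)).
Proof.
elim=> [b|i|{}f g _ pf _ pg|{}f g _ pf _ pg].
- exact: polyfun_cst.
- under eq_fun do rewrite mxE; apply: polyfunM; first exact: polyfun_cst.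
  exact: polyfun_coord.
- exact: polyfunD.
- exact: polyfunM.
Qed.

Lemma pderiv_dilation f m x : polyfun f ->
  pderiv (fun y => f (dilation y)) m x = a ^+ w m * pderiv f m (dilation x).
Proof.
elim=> [b|i|{}f g pf ef pg eg|{}f g pf ef pg eg].
- by rewrite !pderiv_cst mulr0.
- under [X in pderiv X]eq_fun do rewrite mxE.
  rewrite (pderivM _ _ _ _ (polyfun_cst _) (polyfun_coord _)) pderiv_cst mul0r add0r.
  by rewrite !pderiv_coord; case: eqP => [->//|_]; rewrite !mulr0.
- by rewrite !pderivD //; [rewrite ef eg mulrDr|exact: polyfun_dilation..].
- rewrite !pderivM //; [|exact: polyfun_dilation..].
  rewrite ef eg; ring.
Qed.

(** The dilation pushes [V] forward to [a ^+ d] times [V]. The component k thus has weight w k - d;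
    keeping d on the left avoids negative exponents. *)
Definition homogeneous d V := forall x k,
  a ^+ d * V (dilation x) 0 k = a ^+ w k * V x 0 k.

(** Push-forward respects brackets, so the factors multiply. It is checked term by term: [E]
    compares each product of a component with a partial derivative, via the chain rule
    [pderiv_dilation]. *)
Lemma homogeneous_lie d e V W : polyvf V -> polyvf W ->
  homogeneous d V -> homogeneous e W -> homogeneous (d + e) (lie V W).
Proof.
move=> pV pW hV hW.
have E p q Y Z x k m : polyvf Y -> polyvf Z -> homogeneous p Y -> homogeneous q Z ->
    a ^+ p * a ^+ q * (Y (dilation x) 0 m * pderiv (fun y => Z y 0 k) m (dilation x)) =
    a ^+ w k * (Y x 0 m * pderiv (fun y => Z y 0 k) m x).
  move=> pY pZ hY hZ.
  have := pderiv_dilation (fun y => Z y 0 k) m x (pZ k).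
  move/(congr1 (fun z => a ^+ q * z)); rewrite -[LHS](_ : pderiv
    (fun y => a ^+ q * Z (dilation y) 0 k) m x = _); last first.
    rewrite (pderivM _ _ _ _ (polyfun_cst _) (polyfun_dilation _ (pZ k))).
    by rewrite pderiv_cst mul0r add0r.
  have -> : (fun y => a ^+ q * Z (dilation y) 0 k) = (fun y => a ^+ w k * Z y 0 k).
    by apply/funext => y; exact: hZ.
  rewrite (pderivM _ _ _ _ (polyfun_cst _) (pZ k)) pderiv_cst mul0r add0r => e1.
  have am : a ^+ w m != 0 by rewrite expf_neq0.
  apply: (mulfI am).
  transitivity ((a ^+ p * Y (dilation x) 0 m) *
     (a ^+ q * (a ^+ w m * pderiv (fun y => Z y 0 k) m (dilation x)))); first by ring.
  rewrite -e1 hY; ring.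
move=> x k; rewrite exprD !mxE -pderivE !mulr_sumr; apply: eq_bigr => m _.
rewrite !mulrBr (E _ _ _ _ _ _ _ pV pW hV hW); congr (_ - _).
by rewrite [a ^+ d * _]mulrC (E _ _ _ _ _ _ _ pW pV hW hV).
Qed.

End Homogeneity.
End PolyFun.

(** * The Grayson-Grossman fields form a frame *)

Section Monomials.
Context {R : realType} {n : nat}.
Implicit Types (x : 'rV[R]_n) (w : seq nat) (m : 'I_n).

(** The divided power of -x indexed by the letter counts of w. With sign and factorial absorbed, the
    partial derivative along m just deletes one letter m and changes the sign ([pderiv_mon]). *)
Definition mon w x : R :=
  \prod_(j < n) ((- x 0 j) ^+ count_mem (j : nat) w / (count_mem (j : nat) w)`!%:R).

Lemma mon_nil x : mon [::] x = 1.
Proof. by apply: big1 => j _; rewrite /= expr0 fact0 divr1. Qed.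

Lemma mon_perm w w' x : perm_eq w w' -> mon w x = mon w' x.
Proof. by move=> /permP e; apply: eq_bigr => j _; rewrite e. Qed.

Lemma mon_cons w m x :
  mon ((m : nat) :: w) x = - x 0 m / (count_mem (m : nat) w).+1%:R * mon w x.
Proof.
rewrite /mon (bigD1 m) //= [in RHS](bigD1 m) //= eqxx add1n mulrA.
congr (_ * _); last first.
  apply: eq_bigr => j jm; rewrite (_ : (m == j :> nat) = false) ?add0n //.
  by apply/negbTE; rewrite eq_sym.
by rewrite exprS factS natrM invfM mulrACA.
Qed.

Lemma mon_rcons w m x :
  mon (rcons w (m : nat)) x = - x 0 m / (count_mem (m : nat) w).+1%:R * mon w x.
Proof. by rewrite -mon_cons; apply: mon_perm; rewrite perm_rcons. Qed.

Lemma mon_eq0 w m x : (m : nat) \in w -> x 0 m = 0 -> mon w x = 0.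
Proof.
by move=> /perm_to_rem/mon_perm -> x0; rewrite mon_cons x0 oppr0 !mul0r.
Qed.

Lemma polyfun_mon w : polyfun (mon w).
Proof.
apply: polyfun_prod => j; apply: polyfunM; last exact: polyfun_cst.
by apply: polyfunX; apply: polyfunN; exact: polyfun_coord.
Qed.

Lemma pderiv_prod0 (I : Type) (l : seq I) (P : pred I) (F : I -> 'rV[R]_n -> R) m x :
  (forall i, polyfun (F i)) -> (forall i, P i -> pderiv (F i) m x = 0) ->
  pderiv (fun y => \prod_(i <- l | P i) F i y) m x = 0.
Proof.
move=> pF dF; elim: l => [|i l IH].
  by under [X in pderiv X]eq_fun do rewrite big_nil; exact: pderiv_cst.
under [X in pderiv X]eq_fun do rewrite big_cons.
case Pi : (P i) => //; rewrite pderivM ?IH ?dF ?mul0r ?mulr0 ?addr0 //.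
exact: polyfun_prod.
Qed.

Lemma pderivXN m i k x :
  pderiv (fun y => (- y 0 i) ^+ k) m x = - (i == m)%:R * (k%:R * (- x 0 i) ^+ k.-1).
Proof.
have pN : polyfun (fun y : 'rV[R]_n => - y 0 i).
  by apply: polyfunN; exact: polyfun_coord.
elim: k => [|k IH].
  by under [X in pderiv X]eq_fun do rewrite expr0; rewrite pderiv_cst mul0r mulr0.
under [X in pderiv X]eq_fun do rewrite exprS.
rewrite pderivM //; last exact: polyfunX.
rewrite IH pderivN; last exact: polyfun_coord.
rewrite pderiv_coord; case: k {IH} => [|k] /=.
  by rewrite !expr0; ring.
by rewrite exprS -(natr1 k.+1); ring.
Qed.

Lemma pderiv_mon w m x : pderiv (mon w) m x =
  if (m : nat) \in w then - mon (rem (m : nat) w) x else 0.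
Proof.
pose F (j : 'I_n) (y : 'rV[R]_n) := (- y 0 j) ^+ count_mem (j : nat) w / (count_mem (j : nat) w)`!%:R.
have pX j k : polyfun (fun y : 'rV[R]_n => (- y 0 j) ^+ k).
  by apply: polyfunX; apply: polyfunN; exact: polyfun_coord.
have pF j : polyfun (F j).
  by apply: polyfunM; [exact: pX|exact: polyfun_cst].
have dF j : pderiv (F j) m x =
   - (j == m)%:R * ((count_mem (j : nat) w)%:R * (- x 0 j) ^+ (count_mem (j : nat) w).-1)
    / (count_mem (j : nat) w)`!%:R.
  by rewrite pderivM ?pderiv_cst ?pderivXN ?mulr0 ?addr0 //; exact: polyfun_cst.
have -> : mon w = fun y => F m y * \prod_(j < n | j != m) F j y.
  by apply/funext => y; rewrite /mon (bigD1 m).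
rewrite pderivM //; last exact: polyfun_prod.
rewrite pderiv_prod0 // ?mulr0 ?addr0; last first.
  by move=> j /negbTE jm; rewrite dF jm oppr0 !mul0r.
rewrite dF eqxx; case: ifP => [mw|/negbT/count_memPn ->]; last first.
  by rewrite !(mul0r, mulr0).
rewrite /mon [in RHS](bigD1 m) //= -mulNr; congr (_ * _); last first.
  apply: eq_bigr => j jm; rewrite /F count_rem mw /= (_ : (m == j :> nat) = false) ?subn0 //.
  by apply/negbTE; rewrite eq_sym.
rewrite count_rem mw /= eqxx subn1.
have : (0 < count_mem (m : nat) w)%N by rewrite -has_count has_pred1.
case: (count_mem (m : nat) w) => // k _ /=.
rewrite factS natrM invfM.
have : k.+1%:R != 0 :> R by rewrite pnatr_eq0.
have : k`!%:R != 0 :> R by rewrite pnatr_eq0 -lt0n fact_gt0.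
by move=> h1 h2; field; rewrite h1 addrC natr1 h2.
Qed.

Lemma mon_expand w x : all (fun q => (q < n)%N) w ->
  mon w x = (-1) ^+ size w / (\prod_(j < n) (count_mem (j : nat) w)`!)%:R
            * \prod_(j < n) x 0 j ^+ count_mem (j : nat) w.
Proof.
move=> wn; rewrite /mon big_split /= prodfV -natr_prod mulrAC; congr (_ / _).
under eq_bigr do rewrite exprNn; rewrite big_split /=; congr (_ * _).
rewrite prodrXr; congr (_ ^+ _).
elim: w wn => [|q w IH] /=; first by rewrite big1.
move=> /andP[qn /IH <-]; rewrite big_split /= -add1n; congr addn.
rewrite (bigD1 (Ordinal qn)) //= eqxx big1 // => j jq.
by apply/eqP; rewrite eqb0; apply: contra jq => /eqP qj; apply/eqP/val_inj.
Qed.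

(** Allows differentiating an identity known only on a coordinate plane, in directions contained in
    that plane. *)
Lemma pdiff_line (f g : 'rV[R]_n -> R) m x :
  (forall h : R, f (h *: delta_mx 0 m + x) = g (h *: delta_mx 0 m + x)) ->
  pdiff f m x = pdiff g m x.
Proof.
move=> e; rewrite /pdiff /derive.
suff -> : (fun h : R => h^-1 *: ((f \o shift x) (h *: delta_mx 0 m) - f x)) =
  (fun h => h^-1 *: ((g \o shift x) (h *: delta_mx 0 m) - g x)) by [].
apply/funext => h /=; rewrite e.
by have := e 0; rewrite scale0r add0r => ->.
Qed.

End Monomials.

Section Frame.
Context {R : realType} (r s : nat).
Hypothesis s_gt0 : (0 < s)%N.
Local Notation B := (hall r s).
Local Notation n := (hdim r s).
Local Notation str := (hstr r s).
Let HS := hallP r s s_gt0.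
Implicit Types (x : 'rV[R]_n).

Definition hXn l : @vfield R n := hX_aux r s l.+1 l.

Lemma hX_aux_fuel f (l : nat) : (l < f)%N -> @hX_aux R r s f l = hXn l.
Proof.
elim/ltn_ind: l f => l IH [//|f]; rewrite ltnS => lf.
rewrite /hXn /=; case e : (hnth B l).2 => [[a b]|//] /=.
have [ba al _ _ _] := hall_some _ _ _ HS _ _ _ e.
have bl := ltn_trans ba al.
by rewrite !IH // (leq_trans al, leq_trans bl).
Qed.

Lemma hXn_gen l : (hnth B l).2 = None -> hXn l = genX r s l.
Proof. by move=> e; rewrite /hXn /= e. Qed.

Lemma hXn_node l a b : (hnth B l).2 = Some (a, b) -> hXn l = lie (hXn a) (hXn b).
Proof.
move=> e; have [ba al _ _ _] := hall_some _ _ _ HS _ _ _ e.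
by rewrite [LHS]/hXn /= e /= !hX_aux_fuel // (ltn_trans ba).
Qed.

Lemma genXE i x (l : 'I_n) : genX r s i x 0 l =
  if prefix [:: i] (str l) then mon (behead (str l)) x else 0.
Proof.
rewrite mxE; case: ifP => // _; rewrite mon_expand //.
by apply: sub_all (hstr_tail_lt _ _ s_gt0 l) => q /ltn_trans; exact.
Qed.

Lemma polyvf_hXn l : polyvf (hXn l).
Proof.
elim/(hall_indP r s s_gt0): l => [l e k|l a b e pa pb].
  rewrite (hXn_gen _ e); under eq_fun do rewrite genXE.
  by case: (prefix _ (str k)); [exact: polyfun_mon|exact: polyfun_cst].
by rewrite (hXn_node _ _ _ e); exact: polyvf_lie.
Qed.

Local Notation deg i := (hdeg B i).

(** The degree of l is the sum of the degrees of its letters. The first letter is missing from the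
    tail; it is a generator, of degree 1, whence the factor [a] on the left. *)
Lemma mon_dilation (a : R) l x : (l < n)%N ->
  a * mon (behead (str l)) (dilation a (fun i : 'I_n => deg i) x)
  = a ^+ deg l * mon (behead (str l)) x.
Proof.
elim/(hall_indP r s s_gt0): l => [l e ln|l p q e IH _ ln].
  rewrite (hstr_gen _ _ _ e) /= !mon_nil.
  have lr := hall_none _ _ _ HS _ ln e.
  by have [_] := hall_gen _ _ _ HS _ lr; rewrite /hdeg => ->; rewrite expr1.
have [qp pl _ -> _] := hall_some _ _ _ HS _ _ _ e.
have pn := ltn_trans pl ln; have qn := ltn_trans qp pn.
rewrite (behead_hstr_node _ _ s_gt0 _ _ _ e) -[q]/(nat_of_ord (Ordinal qn)) !mon_rcons.
rewrite mxE /= exprD mulrCA IH //; ring.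
Qed.

Lemma homogeneous_hXn (a : R) l : a != 0 -> (l < n)%N ->
  homogeneous a (fun i : 'I_n => deg i) (deg l) (hXn l).
Proof.
move=> a0; elim/(hall_indP r s s_gt0): l => [l e ln x k|l p q e IHp IHq ln].
  rewrite (hXn_gen _ e) !genXE.
  have [_] := hall_gen _ _ _ HS _ (hall_none _ _ _ HS _ ln e).
  rewrite /(hdeg _ l) => -> /=; rewrite expr1.
  by case: ifP => _; [exact: mon_dilation|rewrite !mulr0].
have [qp pl _ -> _] := hall_some _ _ _ HS _ _ _ e.
have pn := ltn_trans pl ln; have qn := ltn_trans qp pn.
rewrite (hXn_node _ _ _ e); apply: homogeneous_lie => //; try exact: polyvf_hXn.
- exact: IHp.
- exact: IHq.
Qed.

Definition vanish_below b x := forall m : 'I_n, (m < b)%N -> x 0 m = 0.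

Lemma vanish_below_line b (m : 'I_n) x (h : R) : (b <= m)%N -> vanish_below b x ->
  vanish_below b (h *: delta_mx 0 m + x).
Proof.
move=> bm vx p pb; rewrite !mxE vx // eqxx /=.
by case: eqP => [pm|_]; [move: pb; rewrite pm ltnNge bm|rewrite mulr0 addr0].
Qed.

(** The coefficient formula of the generators, extended to every l: the monomial of the letters that
    follow the string of l. *)
Definition nodeX l x k : R :=
  if prefix (str l) (str k) then mon (drop (size (str l)) (str k)) x else 0.

(** A proper extension of the string of b contains a letter below b, whose coordinate vanishes on
    this plane. *)
Lemma nodeX_last (b : nat) x (k : 'I_n) : vanish_below b x -> nodeX b x k = (k == b :> nat)%:R.
Proof.
move=> vx; rewrite /nodeX; case: ifP => [/(hstr_prefixP _ _ s_gt0)|/negbT kb].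
  case=> [->|[q [w [e qb bk]]]]; first by rewrite drop_size mon_nil eqxx.
  rewrite e drop_size_cat // gtn_eqF //.
  have qn : (q < n)%N by exact: ltn_trans qb (ltn_trans bk (ltn_ord k)).
  by apply: (mon_eq0 _ (Ordinal qn)); rewrite ?inE ?eqxx // vx.
by case: eqP kb => // ->; rewrite prefix_refl.
Qed.

(** Let q be the first letter after the string of a in that of k. If q < b, the monomial vanishes on
    the plane; if q > b, sortedness keeps b out of the remaining letters, so the derivative is zero;
    if q = b, the derivative deletes this letter and leaves what follows the string of l. *)
Lemma nodeX_pderiv l a (b : 'I_n) x (k : nat) :
  (hnth B l).2 = Some (a, b : nat) -> vanish_below b x ->
  - pdiff (fun y => nodeX a y k) b x = nodeX l x k.
Proof.
move=> e vx; have el := hstr_node _ _ s_gt0 _ _ _ e.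
rewrite {2}/nodeX; case: (boolP (prefix (str a) (str k))) => ak; last first.
  have -> : (fun y => nodeX a y k) = fun=> 0 by apply/funext => y; rewrite /nodeX (negbTE ak).
  rewrite -pderivE pderiv_cst oppr0 ifF //; apply: contraNF ak.
  by apply: prefix_trans; rewrite el prefix_rcons.
have -> : (fun y => nodeX a y k) = mon (drop (size (str a)) (str k)).
  by apply/funext => y; rewrite /nodeX ak.
have [ka|[q [w [ek qa la]]]] := hstr_prefixP _ _ s_gt0 _ _ ak.
  rewrite ka drop_size ifF -?pderivE ?pderiv_mon ?oppr0 //.
  by apply/negP => /size_prefix; rewrite el size_rcons ltnn.
have so := hstr_prefix_sorted _ _ s_gt0 _ _ _ _ ek.
rewrite ek drop_size_cat // el -cats1 prefix_catr // -pderivE.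
rewrite eqxx /= prefix0s andbT eq_sym.
have [qb|qb|qb] := ltngtP q b.
- have qn := ltn_trans qb (ltn_ord b).
  have -> : pderiv (mon (q :: w)) b x = pderiv (fun=> 0) b x; last first.
    by rewrite pderiv_cst oppr0.
  rewrite pderivE; apply: pdiff_line => h.
  apply: (mon_eq0 _ (Ordinal qn)); first by rewrite inE eqxx.
  by rewrite (vanish_below_line b).
- rewrite pderiv_mon ifF ?oppr0 //; apply/negbTE.
  rewrite inE negb_or (ltn_eqF qb) /=; apply/negP => bw.
  have /allP/(_ _ bw) := order_path_min leq_trans so.
  by rewrite leqNgt qb.
- rewrite pderiv_mon qb inE eqxx /= eqxx opprK.
  by rewrite size_cat addn1 -cat_rcons -(size_rcons (str a) b) drop_size_cat.
Qed.

(* Grayson-Grossman: the bracket fields keep the monomial form of the generators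
   on the plane where the coordinates before the last letter vanish. *)
Lemma hXn_nodeX l x (k : 'I_n) : (l < n)%N ->
  (forall a b, (hnth B l).2 = Some (a, b) -> vanish_below b x) ->
  hXn l x 0 k = nodeX l x k.
Proof.
elim/(hall_indP r s s_gt0): l x k => [l e x k ln _|l a b e IHa IHb x k ln vx].
  by rewrite (hXn_gen _ e) genXE /nodeX (hstr_gen _ _ _ e) /= drop1.
have {}vx := vx _ _ e.
have [ba al _ _ lst] := hall_some _ _ _ HS _ _ _ e.
have an := ltn_trans al ln; have bn := ltn_trans ba an.
have vle p y : (p <= b)%N -> vanish_below b y -> vanish_below p y.
  by move=> pb vy m /leq_trans/(_ pb)/vy.
have Xb y m : vanish_below b y -> hXn b y 0 m = (m == b :> nat)%:R.
  move=> vy; rewrite IHb ?nodeX_last // => h p eb.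
  have [pb hb _ _ _] := hall_some _ _ _ HS _ _ _ eb.
  by apply: vle vy; rewrite ltnW // (ltn_trans pb).
have Xa y m : vanish_below b y -> hXn a y 0 m = nodeX a y m.
  by move=> vy; rewrite IHa // => h p /lst/vle; exact.
(* The derivative of X_b along X_a vanishes: X_a has components only in directions m > b, along
   which X_b stays equal to the b-th basis vector. *)
rewrite (hXn_node _ _ _ e) mxE sumrB big1 => [|m _]; last first.
  rewrite Xa // /nodeX; case: ifP => [/(hstr_prefixP _ _ s_gt0) am|]; last by rewrite mul0r.
  have bm : (b < m)%N by case: am => [->//|[_ [_ [_ _]]]]; exact: ltn_trans.
  rewrite (pdiff_line _ (fun=> (k == b :> nat)%:R)) => [|h].
    by rewrite -pderivE pderiv_cst mulr0.
  by rewrite Xb //; apply: vanish_below_line => //; exact: ltnW.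
(* Since X_b is the b-th basis vector here, only minus the b-th partial derivative of X_a
   remains. *)
rewrite sub0r (bigD1 (Ordinal bn)) //= Xb // eqxx mul1r big1 ?addr0 => [|m mb].
  rewrite (pdiff_line _ (fun y => nodeX a y k)) => [|h]; last first.
    by rewrite Xa //; exact: vanish_below_line.
  exact: nodeX_pderiv.
by rewrite Xb // -(inj_eq val_inj) in mb *; rewrite (negbTE mb) mul0r.
Qed.

Lemma hX_at0 (l : 'I_n) : hX r s l 0 = delta_mx 0 l :> 'rV[R]_n.
Proof.
apply/rowP => k; rewrite -[hX r s l]/(hXn l) hXn_nodeX //; last first.
  by move=> a b _ m _; rewrite mxE.
rewrite nodeX_last => [|m _]; last by rewrite mxE.
by rewrite !mxE eqxx.
Qed.

End Frame.

(** * Exponentials of nilpotent matrices *)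

Section MatrixDerivative.
Context {R : realType}.

Definition mxderiv {p q} (M : R -> 'M[R]_(p, q)) (t : R) (M' : 'M[R]_(p, q)) :=
  forall i j, is_derive t (1 : R) (fun u => M u i j) (M' i j).

Lemma is_derive_fsum (I : Type) (l : seq I) (P : pred I) (F : I -> R -> R) (dF : I -> R) t :
  (forall i, is_derive t (1 : R) (F i) (dF i)) ->
  is_derive t (1 : R) (fun u => \sum_(i <- l | P i) F i u) (\sum_(i <- l | P i) dF i).
Proof.
move=> dFP; elim: l => [|i l IH].
  by under eq_fun do rewrite big_nil; rewrite big_nil; exact: is_derive_cst.
under eq_fun do rewrite big_cons; rewrite big_cons; case: (P i) => //.
exact: (@is_deriveD _ _ _ (F i) (fun u => \sum_(i <- l | P i) F i u)).
Qed.

Lemma is_derive_fmul (f g : R -> R) (df dg t : R) :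
  is_derive t (1 : R) f df -> is_derive t (1 : R) g dg ->
  is_derive t (1 : R) (fun u => f u * g u) (df * g t + f t * dg).
Proof.
move=> hf hg; have -> : (fun u => f u * g u) = f * g by [].
by apply: (is_derive_eq (is_deriveM hf hg)); rewrite addrC [_ *: df]mulrC.
Qed.

Lemma mxderiv_cst {p q} (M : 'M[R]_(p, q)) t : mxderiv (fun=> M) t 0.
Proof. by move=> i j; rewrite mxE; exact: is_derive_cst. Qed.

Lemma mxderiv_eq {p q} (M : R -> 'M[R]_(p, q)) t M1 M2 :
  mxderiv M t M1 -> M1 = M2 -> mxderiv M t M2.
Proof. by move=> h <-. Qed.

Lemma mxderivM {p q l} (M : R -> 'M[R]_(p, q)) (N : R -> 'M[R]_(q, l)) t M' N' :
  mxderiv M t M' -> mxderiv N t N' ->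
  mxderiv (fun u => M u *m N u) t (M' *m N t + M t *m N').
Proof.
move=> hM hN i j; rewrite !mxE -big_split /=.
under eq_fun do rewrite mxE.
by apply: is_derive_fsum => k; exact: is_derive_fmul.
Qed.

Lemma mxderiv_comp {p q} (M : R -> 'M[R]_(p, q)) (f : R -> R) t df M' :
  is_derive t (1 : R) f df -> mxderiv M (f t) M' -> mxderiv (fun u => M (f u)) t (df *: M').
Proof.
move=> hf hM i j; rewrite mxE mulrC.
exact: (@is_derive1_comp _ (fun u => M u i j) f t (M' i j) df).
Qed.

Lemma mxderiv0_cst {p q} (M : R -> 'M[R]_(p, q)) t u :
  (forall v, mxderiv M v 0) -> M t = M u.
Proof.
move=> h; apply/matrixP => i j.
apply: (@is_derive_0_is_cst _ (fun u => M u i j) t u) => v.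
by have := h v i j; rewrite mxE.
Qed.

End MatrixDerivative.

Section TruncatedExp.
Context {R : realType} {n : nat} (s : nat) (N : 'M[R]_n).
Hypothesis N_nilp : N ^+ s.+1 = 0.

Definition texp (t : R) : 'M[R]_n := \sum_(a < s.+1) (t ^+ a / a`!%:R) *: N ^+ a.

Lemma texp0 : texp 0 = 1.
Proof.
rewrite /texp big_ord_recl /= fact0 expr0 divr1 scale1r big1 ?addr0 // => i _.
by rewrite expr0n mul0r scale0r.
Qed.

Lemma texpC t : N * texp t = texp t * N.
Proof.
rewrite mulr_sumr mulr_suml; apply: eq_bigr => a _.
by rewrite -mulmxE -scalemxAr -scalemxAl mulmxE -exprS -exprSr.
Qed.

Lemma texp_deriv t : mxderiv texp t (N *m texp t).
Proof.
move=> i j; pose g (a : nat) (u : R) := (u ^+ a / a`!%:R) * (N ^+ a) i j.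
have -> : (fun u => texp u i j) = fun u => \sum_(a < s.+1) g a u.
  by apply/funext => u; rewrite summxE; apply: eq_bigr => a _; rewrite mxE.
have dg (a : nat) : is_derive t (1 : R) (g a)
    (if a is b.+1 then (t ^+ b / b`!%:R) * (N ^+ b.+1) i j else 0).
  have -> : g a = fun u => ((N ^+ a) i j / a`!%:R) * u ^+ a.
    by apply/funext => u; rewrite /g mulrC mulrCA [RHS]mulrC.
  have h : is_derive t (1 : R) (fun u => u ^+ a) (a%:R * t ^+ a.-1).
    have -> : (fun u : R => u ^+ a) = (id : R -> R) ^+ a.
      by apply/funext => u; rewrite exprfctE.
    apply: (is_derive_eq (@is_deriveX R _ id a t 1 1 (is_derive_id t (1 : R)))).
    by rewrite [_ *: _]mulr1.
  apply: (is_derive_eq (is_derive_fmul _ _ _ _ t (is_derive_cst _ _ _) h)).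
  case: a {h} => [|b]; first by rewrite !(mul0r, mulr0n, mulr0, addr0).
  have E (p q u v m : R) : p != 0 -> 0 * v + m / (p * q) * (p * u) = u / q * m.
    by move=> p0; rewrite mul0r add0r invfM [p^-1 * _]mulrC !mulrA mulfVK // mulrC mulrA mulrAC.
  by rewrite factS natrM; apply: E; rewrite pnatr_eq0.
apply: (is_derive_eq (is_derive_fsum 'I_s.+1 _ _ (fun a => g a) _ t (fun a => dg a))).
(* Differentiation kills the term of order 0; multiplication by N shifts the orders up, and the top
   term disappears because [N ^+ s.+1 = 0]. *)
rewrite big_ord_recl add0r -[N *m _]/(N * _) mulr_sumr big_ord_recr /=.
rewrite -mulmxE -scalemxAr mulmxE -exprS N_nilp scaler0 addr0 summxE.
by apply: eq_bigr => a _; rewrite -mulmxE -scalemxAr mulmxE -exprS mxE.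
Qed.

Lemma texpN_deriv t : mxderiv (fun u => texp (- u)) t (- (N *m texp (- t))).
Proof.
rewrite -scaleN1r; apply: mxderiv_comp (texp_deriv _).
Qed.

(** The product has derivative zero, as N commutes with its exponential, and equals 1 at t = 0. *)
Lemma texpK t : texp t *m texp (- t) = 1%:M.
Proof.
have -> : 1%:M = texp 0 *m texp (- 0) by rewrite oppr0 texp0 mulmx1.
apply: (mxderiv0_cst (fun t => texp t *m texp (- t))) => v.
apply: (mxderiv_eq _ _ _ _ (mxderivM _ _ _ _ _ (texp_deriv v) (texpN_deriv v))).
by rewrite mulmxN mulmxA mulmxE texpC subrr.
Qed.

(* If [y |-> y *m N] is the bracket with N and [D] is the adjoint representation, then
   [texp] is an automorphism.  Proof: texp t * D (y * texp t) * texp (- t) has zero derivative. *)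
Lemma texp_conj (A : 'I_n -> 'M[R]_n) (D := fun y : 'rV[R]_n => \sum_k y 0 k *: A k)
  (y : 'rV[R]_n) (t : R) :
  (forall y, D y *m N - N *m D y = D (y *m N)) ->
  D y *m texp t = texp t *m D (y *m texp t).
Proof.
move=> hD; pose K t := texp t *m D (y *m texp t) *m texp (- t).
have dD u : mxderiv (fun u => D (y *m texp u)) u (D (y *m texp u *m N)).
  have := mxderivM _ _ _ _ _ (mxderiv_cst y u) (texp_deriv u).
  rewrite mul0mx add0r mulmxE texpC -mulmxE mulmxA => h i j.
  under eq_fun do rewrite summxE; rewrite summxE.
  under eq_fun do under eq_bigr do rewrite mxE.
  under [X in is_derive _ _ _ X]eq_bigr do rewrite mxE.
  apply: is_derive_fsum => k.
  apply: (is_derive_eq (is_derive_fmul _ _ _ _ u (h 0 k) (is_derive_cst _ _ _))).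
  by rewrite mulr0 addr0.
have K0 : K t = K 0.
  apply: mxderiv0_cst => u.
  apply: (mxderiv_eq _ _ _ _ (mxderivM _ _ _ _ _
    (mxderivM _ _ _ _ _ (texp_deriv u) (dD u)) (texpN_deriv u))).
  have NE : N *m texp u = texp u *m N := texpC u.
  (* By [hD] the derivative of the middle factor is a commutator with N, which cancels the
     derivatives of the two outer factors. *)
  by rewrite -hD mulmxBr mulmxN !mulmxDl mulNmx !mulmxA NE addrCA subrr addr0 subrr.
have : K t *m texp t = texp t *m D (y *m texp t).
  by rewrite /K -mulmxA (mulmx1C (texpK t)) mulmx1.
by rewrite K0 /K oppr0 texp0 !mulmx1 mul1mx.
Qed.

End TruncatedExp.

(** * The adjoint representation in second-kind coordinates *)

Section StructureConstants.
Context {R : realType} (r s : nat).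
Hypothesis s_gt0 : (0 < s)%N.
Local Notation B := (hall r s).
Local Notation n := (hdim r s).
Local Notation str := (hstr r s).
Local Notation deg i := (hdeg (hall r s) i).
Variable c : 'I_n -> 'I_n -> 'I_n -> R.
Hypothesis hc : forall (i j : 'I_n) (x : 'rV[R]_n),
  lie (hX r s i) (hX r s j) x = \sum_(k < n) c i j k *: hX r s k x.
Let HS := hallP r s s_gt0.
Implicit Types (x y : 'rV[R]_n) (m : 'I_n).

Definition comb y : @vfield R n := fun x => \sum_k y 0 k *: hX r s k x.

Lemma comb_at0 y : comb y 0 = y.
Proof.
by rewrite [RHS]row_sum_delta; apply: eq_bigr => k _; rewrite hX_at0.
Qed.

Definition adR m : 'M[R]_n := \matrix_(i, k) c i m k.
Definition ad y : 'M[R]_n := \sum_k y 0 k *: adR k.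

Lemma polyvf_hX m : polyvf (@hX R r s m). Proof. exact: polyvf_hXn. Qed.

Lemma lie_hX i j : lie (hX r s i) (hX r s j) = comb (row i (adR j)).
Proof.
by apply/funext => x; rewrite hc; apply: eq_bigr => k _; rewrite !mxE.
Qed.

Lemma lie_comb y m : lie (comb y) (hX r s m) = comb (y *m adR m).
Proof.
apply/funext => x; rewrite lie_suml; last by move=> i; exact: polyvf_hX.
under eq_bigr do rewrite hc scaler_sumr.
rewrite exchange_big; apply: eq_bigr => k _ /=.
by rewrite mxE scaler_suml; apply: eq_bigr => i _; rewrite scalerA mxE.
Qed.

Lemma cE i j k : c i j k = lie (hX r s i) (hX r s j) 0 0 k.
Proof. by rewrite lie_hX comb_at0 !mxE. Qed.

(** The origin is fixed by dilations, so homogeneity of [X_i, X_j] at 0 equates two powers of the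
    scale times c i j k. The scale 2 separates all exponents. *)
Lemma c_deg i j k : c i j k != 0 -> deg k = (deg i + deg j)%N.
Proof.
move=> cn0; have two : (2 : R) != 0 by rewrite pnatr_eq0.
have := homogeneous_lie 2 (fun i : 'I_n => deg i) two _ _ _ _
  (polyvf_hX i) (polyvf_hX j)
  (homogeneous_hXn _ _ s_gt0 2 i two (ltn_ord i))
  (homogeneous_hXn _ _ s_gt0 2 j two (ltn_ord j)).
move/(_ 0 k); rewrite (_ : dilation _ _ 0 = 0); last first.
  by apply/rowP => p; rewrite !mxE mulr0.
rewrite -cE => /(mulIf cn0)/eqP.
by rewrite -!natrX eqr_nat eqn_exp2l // => /eqP ->.
Qed.

(** Row p is the Jacobi identity for X_p, X_i, X_j evaluated at the origin. *)
Lemma adR_jacobi i j : adR i *m adR j - adR j *m adR i = \sum_k c i j k *: adR k.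
Proof.
apply/row_matrixP => p; have := lie_jacobi (hX r s p) (hX r s i) (hX r s j) 0
  (polyvf_hX p) (polyvf_hX i) (polyvf_hX j).
rewrite !(lie_hX p) !lie_comb !comb_at0 -!row_mul lie_hX.
rewrite lie_sumr; last by move=> k; exact: polyvf_hX.
rewrite raddfB /= => ->; rewrite addrAC subrr add0r raddf_sum /=.
by apply: eq_bigr => k _; rewrite lie_hX comb_at0 !mxE linearZ.
Qed.

Lemma adD y z : ad (y + z) = ad y + ad z.
Proof. by rewrite -big_split; apply: eq_bigr => k _; rewrite mxE scalerDl. Qed.

Lemma adZ (a : R) y : ad (a *: y) = a *: ad y.
Proof. by rewrite scaler_sumr; apply: eq_bigr => k _; rewrite mxE scalerA. Qed.

Lemma ad_delta m : ad (delta_mx 0 m) = adR m.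
Proof.
rewrite /ad (bigD1 m) //= mxE !eqxx scale1r big1 ?addr0 // => k km.
by rewrite mxE (negbTE km) andbF scale0r.
Qed.

(** The linear extension of [adR_jacobi], in the form required by [texp_conj]. *)
Lemma ad_comm y m : ad y *m adR m - adR m *m ad y = ad (y *m adR m).
Proof.
rewrite mulmx_suml mulmx_sumr -sumrB.
under eq_bigr do rewrite -scalemxAl -scalemxAr -scalerBr adR_jacobi scaler_sumr.
rewrite exchange_big; apply: eq_bigr => k _ /=.
by rewrite mxE scaler_suml; apply: eq_bigr => i _; rewrite scalerA mxE.
Qed.

Lemma adR_exp_deg m p i k : (adR m ^+ p) i k != 0 -> deg k = (deg i + p * deg m)%N.
Proof.
elim: p k => [|p IH] k.
  rewrite mxE mul0n addn0 pnatr_eq0 eqb0 negbK.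
  by move=> /eqP ->.
rewrite exprSr mxE => h.
have [l] : exists l, (adR m ^+ p) i l * adR m l k != 0.
  apply/existsP; apply: contraNT h => /existsPn h.
  by rewrite big1 // => l _; apply/eqP; move: (h l); rewrite negbK.
rewrite mulf_eq0 negb_or [adR m l k]mxE => /andP[/IH el /c_deg ->].
by rewrite el mulSn addnA addnAC.
Qed.

(** Each bracket with X_m raises the degree by at least 1, while all degrees lie between 1 and s. *)
Lemma adR_nilp m : adR m ^+ s.+1 = 0.
Proof.
apply/matrixP => i k; rewrite [RHS]mxE; apply/eqP/negP => /negP/adR_exp_deg e.
have /andP[_] := hall_deg _ _ _ HS _ (ltn_ord k).
have /andP[dm _] := hall_deg _ _ _ HS _ (ltn_ord m).
have := leq_mul (leqnn s.+1) dm; rewrite e; lia.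
Qed.

Lemma comb_delta j : hX r s j = comb (delta_mx 0 j).
Proof.
apply/funext => x; rewrite /comb (bigD1 j) //= mxE !eqxx scale1r big1 ?addr0 //.
by move=> k kj; rewrite mxE (negbTE kj) andbF scale0r.
Qed.

Lemma brX_comb y (alpha : 'I_n -> nat) (l : seq 'I_n) :
  foldl (fun Z j => iter (alpha j) (fun W => lie W (hX r s j)) Z) (comb y) l =
  comb (y *m \prod_(j <- l) adR j ^+ alpha j).
Proof.
elim: l y => [|j l IH] y /=; first by rewrite big_nil mulmx1.
rewrite big_cons -mulmxE mulmxA -IH; congr foldl.
elim: (alpha j) => [|p IHp] /=; first by rewrite expr0 mulmx1.
by rewrite IHp lie_comb exprSr -mulmxE mulmxA.
Qed.

Lemma prod_scalemx (I : Type) (l : seq I) (f : I -> R) (M : I -> 'M[R]_n) :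
  \prod_(i <- l) (f i *: M i) = (\prod_(i <- l) f i) *: \prod_(i <- l) M i.
Proof.
elim: l => [|i l IH]; first by rewrite !big_nil scale1r.
by rewrite !big_cons IH -mulmxE -scalemxAl -scalemxAr scalerA.
Qed.

Definition Ad (l : seq 'I_n) x : 'M[R]_n := \prod_(m <- l) texp s (adR m) (- x 0 m).

Lemma index_enum_ord : index_enum 'I_n = enum 'I_n.
Proof. by rewrite enumT [index_enum _]unlock. Qed.

(** Distributing the product of truncated exponentials gives a sum over multi-indices with entries
    at most s, the very range of [extremalP]; by [cgE] the generalized constants are the entries of
    the products of powers of the [adR j]. *)
Lemma extremalPE (cg : 'I_n -> ('I_n -> nat) -> 'I_n -> R) v i x :
  (forall i alpha x, brX r s (hX r s i) alpha x = \sum_(k < n) cg i alpha k *: hX r s k x) ->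
  extremalP r s cg v i x = (Ad (index_enum 'I_n) x *m v^T) i 0.
Proof.
move=> hcg.
have cgE alpha k : cg i alpha k = (\prod_j adR j ^+ alpha j) i k.
  have := hcg i alpha 0.
  rewrite /brX comb_delta brX_comb comb_at0 -index_enum_ord -rowE.
  rewrite (_ : \sum_k _ = comb (\row_k cg i alpha k) 0); last first.
    by apply: eq_bigr => p _; rewrite mxE.
  by rewrite comb_at0 => /rowP/(_ k); rewrite !mxE.
rewrite /Ad bigA_distr_bigA /= mulmx_suml summxE; apply: eq_bigr => alpha _.
rewrite prod_scalemx -scalemxAl [RHS]mxE [in RHS]mxE.
rewrite [LHS](_ : _ = (\prod_j ((- x 0 j) ^+ alpha j / (alpha j)`!%:R)) *
  \sum_k cg i (fun j => nat_of_ord (alpha j)) k * v 0 k).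
  by congr (_ * _); apply: eq_bigr => k _; rewrite cgE !mxE.
rewrite mulrAC; congr (_ * _).
rewrite big_split /= prodfV -natr_prod mulrAC; congr (_ / _).
under [in RHS]eq_bigr do rewrite exprNn.
by rewrite big_split /= prodrXr.
Qed.

(** The assumptions are the Hall condition for (a, k): either the bracket is a basis element, or its
    degree exceeds s and [c_deg] makes it zero. *)
Lemma c_node (a k l : 'I_n) : (k < a)%N -> all (fun q => q <= k)%N (behead (str a)) ->
  c a k l = ((hnth B l).2 == Some (a : nat, k : nat))%:R.
Proof.
move=> ka tk; have [le_s|gt_s] := leqP (deg a + deg k) s.
  have [|i e] := hall_ex _ _ _ HS _ _ (ltn_ord a) ka le_s.
    move=> h q ea; move: tk; rewrite (behead_hstr_node _ _ s_gt0 _ _ _ ea).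
    by rewrite all_rcons => /andP[].
  have [_ _ ilt _ _] := hall_some _ _ _ HS _ _ _ e.
  have -> : ((hnth B l).2 == Some (a : nat, k : nat)) = (l == Ordinal ilt).
    apply/eqP/eqP => [el|-> //]; apply/val_inj.
    exact: hall_inj _ _ _ HS _ _ _ el e.
  rewrite cE -(_ : hX r s (Ordinal ilt) = lie (hX r s a) (hX r s k)); last first.
    by rewrite -[LHS]/(hXn r s i) (hXn_node _ _ s_gt0 _ _ _ e).
  by rewrite hX_at0 // mxE eqxx.
have /andP[_ ls] := hall_deg _ _ _ HS _ (ltn_ord l).
have lne : deg l <> (deg a + deg k)%N by move=> e; move: gt_s; rewrite -e ltnNge ls.
rewrite (_ : _ == _ = false); last first.
  by apply/eqP => /(hall_some _ _ _ HS)[_ _ _ /lne].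
by apply/eqP/contraT => /c_deg/lne.
Qed.

(* What remains of X_j after applying exp(x_m ad X_m) for m < k successively and dropping,
   before each step, the component along X_m (which that step fixes); the dropped
   coefficient is the m-th coordinate of the field X_j. *)
Definition trunc (k j : nat) x : 'rV[R]_n := \row_l
  (if [&& (k <= l)%N, prefix [:: j] (str l) & all (fun q => q < k)%N (behead (str l))]
   then mon (behead (str l)) x else 0).

(** The part of [trunc k.+1] whose tails contain k exactly p times; by [layer_exp] it is the term of
    order p of exp(- x_k A_k) applied to layer 0. *)
Definition layer (k j p : nat) x : 'rV[R]_n := \row_l
  (if [&& (k < l)%N, prefix [:: j] (str l), all (fun q => q <= k)%N (behead (str l)) &
          count_mem k (behead (str l)) == p]
   then mon (behead (str l)) x else 0).

Lemma trunc0 (j : 'I_n) x : (j < r)%N -> trunc 0 j x = delta_mx 0 j.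
Proof.
move=> jr; have [_ ej] := hall_gen _ _ _ HS _ jr.
have sj : str j = [:: (j : nat)] by apply: hstr_gen; rewrite ej.
apply/rowP => l; rewrite !mxE eqxx /=; case: (eqVneq l j) => [->|lj].
  by rewrite sj /= eqxx mon_nil.
rewrite ifF //; apply/negP => /andP[/prefixP[w e]]; rewrite e /=.
case: w e => // e _; case/eqP: lj; apply/val_inj/(hstr_inj r s s_gt0).
by rewrite /= sj e.
Qed.

Lemma trunc_size j x : trunc n j x = 0.
Proof. by apply/rowP => l; rewrite !mxE leqNgt ltn_ord. Qed.

(** In component k the tail condition holds automatically, so the full coordinate of X_j appears. In
    components beyond k, letters below k are letters at most k with no occurrence of k. *)
Lemma trunc_split (k : 'I_n) j x :
  trunc k j x = genX r s j x 0 k *: delta_mx 0 k + layer k j 0 x.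
Proof.
apply/rowP => l; rewrite [RHS]mxE [X in _ = X + _]mxE [X in _ = _ * X + _]mxE genXE //.
rewrite [LHS]mxE [X in _ = _ + X]mxE eqxx /= leq_eqVlt.
case: (eqVneq l k) => [->|lk].
  by rewrite ltnn eqxx (hstr_tail_lt _ _ s_gt0) andbT /= mulr1 addr0.
rewrite mulr0 add0r (_ : (k == l :> nat) = false) /=; last first.
  by apply/negbTE; rewrite eq_sym.
congr (if _ then _ else _); case: (k < l)%N => //=; congr (_ && _).
rewrite (sameP eqP count_memPn); elim: (behead _) => //= q w ->.
rewrite inE negb_or ltn_neqAle [k == q :> nat]eq_sym.
by case: (_ == _) (_ <= _)%N (all _ _) => [] [] [].
Qed.

(** By [c_node] the component l receives only the a with X_l = [X_a, X_k]; appending the (p+1)-st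
    letter k to the string of a multiplies its monomial by - x_k / (p+1). *)
Lemma layer_step (k : 'I_n) j p x :
  layer k j p.+1 x = (- x 0 k / p.+1%:R) *: (layer k j p x *m adR k).
Proof.
apply/rowP => l; rewrite [RHS]mxE [X in _ = _ * X]mxE.
have cl (a : 'I_n) : layer k j p x 0 a * adR k a l =
    layer k j p x 0 a * ((hnth B l).2 == Some (a : nat, k : nat))%:R.
  rewrite !mxE; case: ifP => [/and4P[ka _ tk _]|_]; last by rewrite !mul0r.
  by rewrite c_node.
under eq_bigr do rewrite cl.
case el : (hnth B l).2 => [[a b]|]; last first.
  rewrite big1 => [|a _]; last by rewrite mulr0.
  by rewrite mxE (hstr_gen _ _ _ el) /= !andbF mulr0.
have [ba al _ _ _] := hall_some _ _ _ HS _ _ _ el.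
have an := ltn_trans al (ltn_ord l).
rewrite mxE (behead_hstr_node _ _ s_gt0 _ _ _ el) (hstr_node _ _ s_gt0 _ _ _ el).
have [bk|bk] := eqVneq b k; last first.
  rewrite big1 => [|a' _]; last first.
    by rewrite (_ : _ == _ = false) ?mulr0 //; apply/eqP => -[_ /eqP]; rewrite (negbTE bk).
  (* A last letter b other than k either exceeds k or, the tail being sorted, excludes k from it. *)
  rewrite mulr0 ifF //; apply/negP => /and4P[_ _].
  rewrite all_rcons => /andP[b_le _]; have {b_le}b_lt : (b < k)%N by rewrite ltn_neqAle bk.
  have [tb _] := hstr_tail_le _ _ s_gt0 _ _ _ el.
  rewrite (behead_hstr_node _ _ s_gt0 _ _ _ el) in tb.
  rewrite (count_memPn _) //; apply/negP => /(allP tb).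
  by rewrite leqNgt b_lt.
subst b; rewrite (bigD1 (Ordinal an)) //= eqxx mulr1 big1 => [|a' aa]; last first.
  rewrite (_ : _ == _ = false) ?mulr0 //; apply/eqP => -[e].
  by case/eqP: aa; apply/val_inj.
rewrite addr0 mxE /= ba (ltn_trans ba al) all_rcons leqnn /= mon_rcons.
have -> : prefix [:: j] (rcons (str a) k) = prefix [:: j] (str a).
  by have [q [w ->]] := hstr_cons r s s_gt0 a; rewrite /= !prefix0s.
rewrite -cats1 count_cat /= eqxx addn0 addn1 eqSS.
by case: ifP => [/and3P[_ _ /eqP ->]|_] //; rewrite mulr0.
Qed.

Lemma layer_exp (k : 'I_n) j p x :
  layer k j p x = ((- x 0 k) ^+ p / p`!%:R) *: (layer k j 0 x *m adR k ^+ p).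
Proof.
elim: p => [|p IH]; first by rewrite !expr0 fact0 divr1 scale1r mulmx1.
rewrite layer_step IH -scalemxAl scalerA (exprSr (adR k)) -mulmxE mulmxA; congr (_ *: _).
by rewrite exprS factS natrM invfM mulrACA.
Qed.

(** Each index lies in exactly one layer, given by the number of letters k in its tail. This number
    is at most s, so truncating the exponential loses nothing. *)
Lemma trunc_step (k : 'I_n) j x :
  layer k j 0 x *m texp s (adR k) (- x 0 k) = trunc k.+1 j x.
Proof.
rewrite mulmx_sumr; under eq_bigr do rewrite -scalemxAr -layer_exp.
apply/rowP => l; rewrite summxE mxE.
have sl : (count_mem (k : nat) (behead (str l)) < s.+1)%N.
  rewrite ltnS (leq_trans (count_size _ _)) // size_behead.
  have /andP[_] := hall_deg _ _ _ HS _ (ltn_ord l); apply: leq_trans.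
  exact: leq_trans (leq_pred _) (size_hstr _ _ s_gt0 _ (ltn_ord l)).
rewrite (bigD1 (Ordinal sl)) //= big1 => [|p pk]; last first.
  rewrite mxE ifF // (_ : _ == _ = false) ?andbF //; apply/negbTE.
  by apply: contra pk => /eqP e; apply/eqP/val_inj.
by rewrite addr0 mxE eqxx andbT.
Qed.

(* Downward induction on k: the suffix product E_k ... E_(n-1) = Q k satisfies
   Q' = - ad (Y k) *m Q, where Y k is the [trunc k] part of the velocity. *)
Lemma Ad_deriv (g : R -> 'rV[R]_n) (h : 'I_n -> R) t :
  (forall k, is_derive t (1 : R) (fun u => g u 0 k)
     (\sum_(j < n | (j < r)%N) h j * hX r s j (g t) 0 k)) ->
  mxderiv (fun u => Ad (index_enum 'I_n) (g u)) t
    (- ((\sum_(j < n | (j < r)%N) h j *: adR j) *m Ad (index_enum 'I_n) (g t))).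
Proof.
move=> dg; pose Y k := \sum_(j < n | (j < r)%N) h j *: trunc k j (g t).
pose gd k := \sum_(j < n | (j < r)%N) h j * hX r s j (g t) 0 k.
pose Q k x := Ad (drop k (enum 'I_n)) x.
have adY0 : \sum_(j < n | (j < r)%N) h j *: adR j = ad (Y 0%N).
  rewrite (big_morph _ adD (_ : ad 0 = 0)); last by rewrite -(scale0r 0) adZ scale0r.
  by apply: eq_bigr => j jr; rewrite adZ trunc0 // ad_delta.
rewrite adY0 index_enum_ord -[enum _ in X in mxderiv X](drop0 _).
rewrite -[enum _ in X in mxderiv _ _ X](drop0 _) -!/(Q _ _).
suff H d k : (k + d = n)%N -> mxderiv (fun u => Q k (g u)) t (- (ad (Y k) *m Q k (g t))).
  exact: (H n 0%N).
elim: d k => [|d IH] k.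
  rewrite addn0 => ->; rewrite (_ : Y n = 0).
  - rewrite -(scale0r 0) adZ scale0r mul0mx oppr0 /Q drop_oversize ?size_enum_ord // /Ad.
    by under eq_fun do rewrite big_nil; exact: mxderiv_cst.
  - by rewrite /Y big1 // => j _; rewrite trunc_size scaler0.
move=> kd; have kn : (k < n)%N by rewrite -kd addnS ltnS leq_addr.
pose K := Ordinal kn; pose E u := texp s (adR K) (- g u 0 K).
have QE u : Q k (g u) = E u *m Q k.+1 (g u).
  rewrite /Q /Ad (drop_nth K) ?size_enum_ord // big_cons mulmxE; congr (_ * _).
  by rewrite /E (_ : nth K _ _ = K) //; apply/val_inj; rewrite /= nth_enum_ord.
have dE : mxderiv E t (- (gd K *: (adR K *m E t))).
  have dK : is_derive t (1 : R) (fun u => - g u 0 K) (- gd K).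
    exact: (@is_deriveN _ _ _ (fun u => g u 0 K)).
  have := mxderiv_comp _ _ _ _ _ dK (texp_deriv s _ (adR_nilp K) (- g t 0 K)).
  by rewrite scaleNr.
under eq_fun do rewrite QE; rewrite QE.
have {IH}dQ := IH k.+1; rewrite addSn -addnS in dQ; have {}dQ := dQ kd.
apply: (mxderiv_eq _ _ _ _ (mxderivM _ _ _ _ _ dE dQ)).
(* The coefficient along X_K is the speed of the K-th coordinate, the one produced by
   differentiating the exponent of E. *)
have -> : Y k = gd K *: delta_mx 0 K + \sum_(j < n | (j < r)%N) h j *: layer k j 0 (g t).
  rewrite /gd scaler_suml -big_split; apply: eq_bigr => j jr /=.
  rewrite (trunc_split K) scalerDr scalerA; congr (_ * _ *: _ + _).
  rewrite -[hX r s j]/(hXn r s j) hXn_gen //.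
  by have [_ ->] := hall_gen _ _ _ HS _ jr.
rewrite adD adZ ad_delta; set L := \sum_(j < n | _) _.
have -> : Y k.+1 = L *m E t.
  rewrite mulmx_suml; apply: eq_bigr => j _.
  by rewrite -scalemxAl (trunc_step K).
(* The automorphism property carries the derivative of the remaining factors to the left of E. *)
have ELE : E t *m ad (L *m E t) = ad L *m E t.
  rewrite /E; apply/esym/(texp_conj s _ (adR_nilp K) adR) => y.
  exact: ad_comm.
rewrite mulNmx mulmxN -opprD [E t *m (_ *m _)]mulmxA ELE mulmxDl -!scalemxAl !mulmxA.
by [].
Qed.

End StructureConstants.

(** * Lipschitz functions with vanishing derivative *)

Section LipschitzConstant.
Context {R : realType}.

(** At the supremum of the t such that P holds on [0, t], the limit hypothesis gives P, and the step
    hypothesis would go further if the supremum were below 1. *)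
Lemma real_induction (P : R -> Prop) : P 0 ->
  (forall t, 0 <= t < 1 -> P t ->
     exists2 d, 0 < d & forall u, t < u < t + d -> u <= 1 -> P u) ->
  (forall t, 0 < t <= 1 -> (forall u, 0 <= u < t -> P u) -> P t) ->
  forall t, 0 <= t <= 1 -> P t.
Proof.
move=> P0 step lim.
pose S := [set t : R | 0 <= t <= 1 /\ forall u, 0 <= u <= t -> P u].
have S0 : S 0.
  split; first by rewrite lexx ler01.
  by move=> u u0; rewrite -(le_anti u0).
have hS : has_sup S by split; [exists 0|exists 1 => t [/andP[]]].
pose m := sup S.
have m0 : 0 <= m by exact: ub_le_sup hS.2 _ S0.
have m1 : m <= 1 by apply: ge_sup; [exact: hS.1|move=> t [/andP[]]].
have below u : 0 <= u < m -> P u.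
  move=> /andP[u0 um]; have [|t [_ tP] ut] := @sup_adherent _ S (m - u) _ hS.
    by rewrite subr_gt0.
  by apply: tP; rewrite u0 ltW //; move: ut; rewrite -/m opprB addrC subrK.
have Pm : P m.
  have [->//|mn0] := eqVneq m 0.
  by apply: lim => //; rewrite lt_neqAle eq_sym mn0 m0.
have upto u : 0 <= u <= m -> P u.
  by move=> /andP[u0]; rewrite le_eqVlt => /orP[/eqP ->//|um]; apply: below; rewrite u0.
suff -> : 1 = m by [].
apply: le_anti; rewrite m1 andbT leNgt; apply/negP => m_lt1.
have [|d d0 dP] := step m _ Pm; first by rewrite m0.
pose w := Num.min (m + d / 2) 1.
have mw : m < w by rewrite lt_min m_lt1 andbT ltrDl divr_gt0.
have w1 : w <= 1 by rewrite ge_min lexx orbT.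
have wd : w < m + d.
  by rewrite gt_min; apply/orP; left; rewrite ltrD2l ltr_pdivrMr // ltr_pMr // ltr1n.
have : S w.
  split; first by rewrite w1 (le_trans m0) // ltW.
  move=> u /andP[u0 uw]; have [um|mu] := leP u m; first by apply: upto; rewrite u0.
  by apply: dP; rewrite ?mu ?(le_lt_trans uw) // (le_trans uw).
by move/(ub_le_sup hS.2); rewrite leNgt -/m mw.
Qed.

(* Outside a null set contained in an open set of measure < e, the increments of [f] are
   o(h); inside that open set they are controlled by its measure. *)
Lemma lipschitz_ae_derive0 (f : R -> R) (L : R) : 0 <= L ->
  (forall t u, 0 <= t <= 1 -> 0 <= u <= 1 -> `|f t - f u| <= L * `|t - u|) ->
  {ae (@lebesgue_measure R), forall t : R, 0 < t < 1 -> is_derive t (1 : R) f 0} ->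
  forall t, 0 <= t <= 1 -> f t = f 0.
Proof.
move=> L0 lip [A0 [mA0 A00 sA0]].
have {}A00 : lebesgue_measure A0 = 0%E := A00.
(* The derivative is known only at interior points, so 0 is treated as exceptional. *)
pose A := A0 `|` [set 0].
have mA : measurable A by apply: measurableU.
have A_0 : lebesgue_measure A = 0%E.
  apply/eqP; rewrite eq_le measure_ge0 andbT.
  apply: (le_trans (measureU2 _ _ _)) => //.
  by rewrite [X in (X + _)%E]A00 add0e [X in (X <= _)%E]lebesgue_measure_set1.
have dA t : ~ A t -> 0 < t < 1 -> is_derive t (1 : R) f 0.
  move=> nA; apply: contrapT => nd; apply: nA; left; apply: sA0.
  by rewrite /= => h; apply: nd; exact: h.
move=> T T01.
suff H e : 0 < e -> `|f T - f 0| <= e * (1 + L).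
  apply/eqP; rewrite -subr_eq0 -normr_le0; apply/ler_addgt0Pl => e e0.
  rewrite addr0; have L1 : 0 < 1 + L by rewrite ltr_wpDr.
  by have := H (e / (1 + L)); rewrite divfK ?gt_eqF //; apply; rewrite divr_gt0.
move=> e0; have [|U [oU AU Ue]] := lebesgue_regularity_outer mA _ e0.
  by rewrite [X in (X < _)%E]A_0 ltry.
have mU : measurable U by exact: open_measurable.
have muU : (lebesgue_measure U < e%:E)%E.
  rewrite -(setDKU AU).
  apply: (le_lt_trans (measureU2 _ _ _)) => //; first exact: measurableD.
  by rewrite [X in (_ + X)%E]A_0 adde0.
pose V t := U `&` `[0, t]%classic.
have mV t : measurable (V t) by apply: measurableI => //; exact: measurable_itv.
pose m t := fine (lebesgue_measure (V t)).
have leM (X Y : set R) : measurable X -> measurable Y -> X `<=` Y ->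
    (lebesgue_measure X <= lebesgue_measure Y)%E.
  by move=> mX mY XY; apply: le_measure; rewrite ?inE.
have mVe t : (lebesgue_measure (V t) < e%:E)%E.
  apply: le_lt_trans muU; apply: (leM _ _ (mV t) mU).
  exact: subIsetl.
have mE t : lebesgue_measure (V t) = (m t)%:E.
  by rewrite /m fineK // ge0_fin_numE // (lt_trans (mVe t)) ?ltry.
have m_ge0 t : 0 <= m t by rewrite /m fine_ge0.
have m_lt t : m t <= e by rewrite -lee_fin -mE ltW.
have m_homo t u : t <= u -> m t <= m u.
  move=> tu; rewrite -lee_fin -!mE; apply: leM; [exact: mV|exact: mV|].
  move=> x [Ux /=]; rewrite !in_itv /= => /andP[x0 xt]; split => //=.
  by rewrite in_itv /= x0 (le_trans xt).
have m_step t u : 0 <= t -> t <= u -> `]t, u]%classic `<=` U -> m t + (u - t) <= m u.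
  move=> t0 tu tuU; rewrite -lee_fin EFinD -!mE.
  have <- : lebesgue_measure (`]t, u]%classic : set R) = (u - t)%:E.
    rewrite lebesgue_measure_itv /= lte_fin; case: ltP => // ut.
    by rewrite (@le_anti _ R t u) ?tu // subrr.
  rewrite -measureU; [|exact: mV|exact: measurable_itv|]; last first.
    apply/seteqP; split => x //= [[_]] /=; rewrite !in_itv /= => /andP[_ xt] /andP[].
    by rewrite ltNge xt.
  apply: leM; [by apply: measurableU; [exact: mV|exact: measurable_itv]|exact: mV|].
  move=> x [[Ux]|]; rewrite /= !in_itv /=.
    by move=> /andP[x0 xt]; split => //=; rewrite in_itv /= x0 (le_trans xt).
  move=> /andP[tx xu]; split; first by apply: tuU; rewrite /= in_itv /= tx.
  by rewrite /= in_itv /= xu (le_trans t0) // ltW.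
(* The invariant: slope e is allowed everywhere, and growth at rate L is charged to the measure of U
   passed so far, which never exceeds e. *)
suff H t : 0 <= t <= 1 -> `|f t - f 0| <= e * t + L * m t.
  apply: (le_trans (H _ T01)); rewrite mulrDr mulr1 lerD //.
    by rewrite ger_pMr //; case/andP: T01.
  by rewrite mulrC ler_wpM2r.
move: t; apply: real_induction.
- by rewrite subrr normr0 mulr0 add0r mulr_ge0.
- move=> t t01 Pt; have /andP[t0 t1] := t01.
  have step u : t < u -> `|f u - f t| <= e * (u - t) + L * (m u - m t) ->
     `|f u - f 0| <= e * u + L * m u.
    move=> tu h; have -> : f u - f 0 = (f u - f t) + (f t - f 0) by ring.
    by apply: (le_trans (ler_normD _ _)); move: h Pt; lra.
  (* At an exceptional t, U contains an interval to the right of t, and m grows there at unit rate.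
     Elsewhere the difference quotients are eventually at most e. *)
  have [At|nAt] := pselect (A t).
    have [d d0 dU] : exists2 d, 0 < d & forall u, t < u < t + d -> `]t, u]%classic `<=` U.
      have /nbhs_ballP[d /= d0 dU] : nbhs t U by exact: open_nbhs_nbhs (conj oU (AU _ At)).
      exists d => // u /andP[tu utd] x /=; rewrite in_itv /= => /andP[tx xu].
      by apply: dU; rewrite /ball /= distrC gtr0_norm ?subr_gt0 //; lra.
    exists d => // u /[dup] tu /andP[tu1 _] u1; apply: step => //.
    have := lip u t; rewrite [`|u - t|]gtr0_norm ?subr_gt0 //.
    rewrite t0 (ltW t1) u1 (le_trans t0 (ltW tu1)).
    move=> /(_ isT isT)/le_trans; apply.
    have := m_step _ _ t0 (ltW tu1) (dU _ tu); rewrite -lerBrDl => /(ler_wpM2l L0)/le_trans.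
    by apply; rewrite lerDr mulr_ge0 ?subr_ge0 // ltW.
  have t_gt0 : 0 < t.
    by rewrite lt_neqAle t0 andbT; apply/eqP => t_0; apply: nAt; right; rewrite -t_0.
  have [|df Df] := dA _ nAt; first by rewrite t_gt0.
  have {df} : (fun h : R => h^-1 *: ((f \o shift t) (h *: 1) - f t)) @ 0^' --> 'D_1 f t.
    exact: df.
  rewrite Df.
  move/cvgrPdist_le => /(_ _ e0) /nbhs_ballP[d /= d0 dP]; exists d => // u /andP[tu utd] u1.
  apply: step => //.
  have ut0 : 0 < u - t by rewrite subr_gt0.
  have := dP (u - t); rewrite /ball /= !sub0r !normrN gtr0_norm // ltrBlDl.
  move=> /(_ utd) /=; rewrite gt_eqF // => /(_ isT).
  rewrite [(u - t) *: 1]mulr1 subrK normrM gtr0_norm ?invr_gt0 //.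
  rewrite mulrC ler_pdivrMr // => h; apply: (le_trans h).
  by rewrite lerDl mulr_ge0 // subr_ge0 m_homo // ltW.
- move=> t /andP[t0 t1] Pt; apply/ler_addgt0Pr => d d0.
  (* So close to t that the Lipschitz bound between u and t costs at most d. *)
  pose u := Num.max 0 (t - d / (1 + L)).
  have L1 : 0 < 1 + L by rewrite ltr_wpDr.
  have u0 : 0 <= u by rewrite le_max lexx.
  have ut : u < t by rewrite gt_max t0 /= ltrBlDr ltrDl divr_gt0.
  have := Pt u; rewrite u0 ut => /(_ isT) hu.
  have : `|f t - f u| <= d.
    apply: le_trans (lip _ _ _ _) _; rewrite ?u0 ?(ltW t0) ?t1 ?(le_trans (ltW ut)) //.
    rewrite gtr0_norm ?subr_gt0 //.
    have : t - u <= d / (1 + L) by rewrite lerBlDl -lerBlDr le_max lexx orbT.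
    move/(ler_wpM2l L0)/le_trans; apply.
    by rewrite mulrCA ger_pMr // ler_pdivrMr // mul1r lerDr.
  have -> : f t - f 0 = (f t - f u) + (f u - f 0) by ring.
  move=> h; apply: (le_trans (ler_normD _ _)).
  have := ler_wpM2l L0 (m_homo _ _ (ltW ut)).
  have : e * u <= e * t by rewrite ler_pM2l // ltW.
  by move: h hu; lra.
Qed.
End LipschitzConstant.

(** * Sums and products of Lipschitz functions on the unit interval *)

Section LipschitzAlgebra.
Context {R : realType}.

Definition lip (f : R -> R) := exists2 L, 0 <= L &
  forall t u, 0 <= t <= 1 -> 0 <= u <= 1 -> `|f t - f u| <= L * `|t - u|.

Lemma lip_cst a : lip (fun=> a).
Proof. by exists 0 => // t u _ _; rewrite subrr normr0 mul0r. Qed.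

Lemma lipD f g : lip f -> lip g -> lip (fun t => f t + g t).
Proof.
move=> [L L0 hf] [K K0 hg]; exists (L + K); first exact: addr_ge0.
move=> t u t01 u01; rewrite opprD addrACA mulrDl.
by apply: (le_trans (ler_normD _ _)); rewrite lerD ?hf ?hg.
Qed.

Lemma lip_bounded f : lip f -> exists2 C, 0 <= C & forall t, 0 <= t <= 1 -> `|f t| <= C.
Proof.
move=> [L L0 hf]; exists (`|f 0| + L) => [|t t01]; first exact: addr_ge0.
have := hf t 0 t01; rewrite lexx ler01 subr0 => /(_ isT) h.
rewrite -[f t](subrK (f 0)) addrC; apply: (le_trans (ler_normD _ _)).
rewrite lerD2l; apply: (le_trans h).
by case/andP: t01 => t0 t1; rewrite ler_piMr // ger0_norm.
Qed.

Lemma lipM f g : lip f -> lip g -> lip (fun t => f t * g t).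
Proof.
move=> lf lg; have [C C0 fC] := lip_bounded _ lf; have [D D0 gD] := lip_bounded _ lg.
have [L L0 hf] := lf; have [K K0 hg] := lg.
exists (L * D + C * K) => [|t u t01 u01]; first by rewrite addr_ge0 // mulr_ge0.
have -> : f t * g t - f u * g u = (f t - f u) * g t + f u * (g t - g u) by ring.
apply: (le_trans (ler_normD _ _)); rewrite !normrM mulrDl lerD //.
  by rewrite mulrAC ler_pM // ?hf ?gD.
by rewrite -mulrA ler_pM // ?hg ?fC.
Qed.

Lemma lip_sum (I : Type) (l : seq I) (P : pred I) (F : I -> R -> R) :
  (forall i, lip (F i)) -> lip (fun t => \sum_(i <- l | P i) F i t).
Proof.
move=> hF; elim: l => [|i l IH].
  by under eq_fun do rewrite big_nil; exact: lip_cst.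
by under eq_fun do rewrite big_cons; case: (P i) => //; exact: lipD.
Qed.

Lemma lipX f k : lip f -> lip (fun t => f t ^+ k).
Proof.
move=> lf; elim: k => [|k IH].
  by under eq_fun do rewrite expr0; exact: lip_cst.
by under eq_fun do rewrite exprS; exact: lipM.
Qed.

Lemma lipschitz01_coord n (f : R -> 'rV[R]_n) k : lipschitz01 f -> lip (fun t => f t 0 k).
Proof.
move=> [L hf]; exists `|L| => // t u t01 u01.
apply: (@le_trans _ _ (L * `|t - u|)); last by rewrite ler_wpM2r // ler_norm.
apply: le_trans (hf _ _ t01 u01).
rewrite [leRHS]/Num.Def.normr /= mx_normrE.
by apply: le_trans (le_bigmax _ _ (0, k)); rewrite !mxE.
Qed.

Definition mxlip {p q} (M : R -> 'M[R]_(p, q)) := forall i j, lip (fun t => M t i j).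

Lemma mxlipM {p q l} (M : R -> 'M[R]_(p, q)) (N : R -> 'M[R]_(q, l)) :
  mxlip M -> mxlip N -> mxlip (fun t => M t *m N t).
Proof.
move=> lM lN i j; under eq_fun do rewrite mxE.
by apply: lip_sum => k; exact: lipM.
Qed.

Lemma mxlip_texp n s (N : 'M[R]_n) (f : R -> R) : lip f ->
  mxlip (fun t => texp s N (f t)).
Proof.
move=> lf i j; under eq_fun do rewrite summxE.
apply: lip_sum => a; under eq_fun do rewrite mxE.
by apply: lipM; [apply: lipM; [exact: lipX|exact: lip_cst]|exact: lip_cst].
Qed.

End LipschitzAlgebra.

(** * Horizontal curves *)

Section ExtremalCurves.
Context {R : realType} (r s : nat).
Hypothesis s_gt0 : (0 < s)%N.
Local Notation n := (hdim r s).
Variable c : 'I_n -> 'I_n -> 'I_n -> R.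
Hypothesis hc : forall (i j : 'I_n) (x : 'rV[R]_n),
  lie (hX r s i) (hX r s j) x = \sum_(k < n) c i j k *: hX r s k x.
Let HS := hallP r s s_gt0.
Local Notation A := (adR r s c).

(** The inverse of [Ad], written as a product of exponentials so that it is visibly Lipschitz and
    differentiable along curves. *)
Definition AdV (l : seq 'I_n) (x : 'rV[R]_n) : 'M[R]_n :=
  \prod_(m <- rev l) texp s (A m) (x 0 m).

Lemma AdVK l x : AdV l x *m Ad r s c l x = 1%:M.
Proof.
elim: l => [|m l IH]; first by rewrite /AdV /Ad !big_nil mulmx1.
rewrite /AdV rev_cons -cats1 big_cat big_seq1 -/(AdV l x) /Ad big_cons -/(Ad r s c l x).
rewrite -mulmxE -mulmxA [X in _ *m X]mulmxA texpK ?mul1mx //.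
exact: adR_nilp.
Qed.

Lemma Ad0 l : Ad r s c l 0 = 1.
Proof.
by rewrite /Ad big1 // => m _; rewrite mxE oppr0 texp0.
Qed.

Lemma mxlip_AdV l (g : R -> 'rV[R]_n) : (forall k, lip (fun t => g t 0 k)) ->
  mxlip (fun t => AdV l (g t)).
Proof.
move=> lg; rewrite /AdV; elim: (rev l) => [|m w IH].
  by move=> i j; under eq_fun do rewrite big_nil; exact: lip_cst.
under eq_fun do rewrite big_cons -mulmxE.
by apply: mxlipM => //; exact: mxlip_texp.
Qed.

Lemma mxderiv_AdV l (g : R -> 'rV[R]_n) t :
  (forall k, exists d, is_derive t (1 : R) (fun u => g u 0 k) d) ->
  exists M', mxderiv (fun u => AdV l (g u)) t M'.
Proof.
move=> dg; rewrite /AdV; elim: (rev l) => [|m w [M' IH]].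
  by exists 0; under eq_fun do rewrite big_nil; exact: mxderiv_cst.
have [d dgm] := dg m; eexists.
under eq_fun do rewrite big_cons -mulmxE.
apply: mxderivM IH; apply: mxderiv_comp dgm _; apply: texp_deriv.
exact: adR_nilp.
Qed.

(** Identifies the controls of a horizontal curve with the first r components of its velocity. *)
Lemma hX_gen_coord (j k : 'I_n) x : (j < r)%N -> (k < r)%N ->
  hX r s j x 0 k = (k == j)%:R :> R.
Proof.
move=> jr kr; have [_ ej] := hall_gen _ _ _ HS _ jr.
have [_ ek] := hall_gen _ _ _ HS _ kr.
rewrite -[hX r s j]/(hXn r s j) hXn_gen ?ej // genXE // hstr_gen ?ek //=.
by rewrite mon_nil andbT [RHS](_ : _ = (j == k :> nat)%:R) ?[k == j]eq_sym //; case: eqP.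
Qed.

Definition velocity (w : 'rV[R]_n) : 'M[R]_n := \sum_(j < n | (j < r)%N) w 0 j *: A j.

Lemma velocityE w (y : 'rV[R]_n) i : (- (velocity w *m y^T)) i 0 =
  - \sum_(k < n) \sum_(j < n | (j < r)%N) c i j k * w 0 j * y 0 k.
Proof.
rewrite mxE mxE; congr (- _); apply: eq_bigr => k _.
rewrite mxE summxE mulr_suml; apply: eq_bigr => j _.
by rewrite !mxE [w 0 j * _]mulrC.
Qed.

Lemma is_derive_row (g : R -> 'rV[R]_n) t k : derivable g t 1 ->
  is_derive t (1 : R) (fun u => g u 0 k) (('D_1 g t) 0 k).
Proof.
move=> dg; rewrite derive_mx // mxE; apply: DeriveDef => //.
exact: (derivable_mxP _ _ _).1 dg 0 k.
Qed.

Lemma Ad_curve_deriv (g : R -> 'rV[R]_n) (h : 'I_n -> R) t : derivable g t 1 ->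
  'D_1 g t = \sum_(j < n | (j < r)%N) h j *: hX r s j (g t) ->
  mxderiv (fun u => Ad r s c (index_enum 'I_n) (g u)) t
    (- (velocity ('D_1 g t) *m Ad r s c (index_enum 'I_n) (g t))).
Proof.
move=> dg Dg; rewrite (_ : velocity _ = \sum_(j < n | (j < r)%N) h j *: A j).
  apply: Ad_deriv => // k; apply: (is_derive_eq (is_derive_row g t k dg)).
  by rewrite Dg summxE; apply: eq_bigr => j _; rewrite mxE.
apply: eq_bigr => j jr; congr (_ *: _); rewrite Dg summxE (bigD1 j) //=.
rewrite mxE hX_gen_coord // eqxx mulr1 big1 ?addr0 // => k /andP[kr kj].
by rewrite mxE hX_gen_coord // eq_sym (negbTE kj) mulr0.
Qed.

End ExtremalCurves.

Theorem theorem4p6 (R : realType) (r s : nat) (hr : (2 <= r)%N) (hs : (2 <= s)%N)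
  (c : 'I_(hdim r s) -> 'I_(hdim r s) -> 'I_(hdim r s) -> R)
  (hc : forall (i j : 'I_(hdim r s)) (x : 'rV[R]_(hdim r s)),
     lie (hX r s i) (hX r s j) x = \sum_(k < hdim r s) c i j k *: hX r s k x)
  (cg : 'I_(hdim r s) -> ('I_(hdim r s) -> nat) -> 'I_(hdim r s) -> R)
  (hcg : forall (i : 'I_(hdim r s)) (alpha : 'I_(hdim r s) -> nat)
                (x : 'rV[R]_(hdim r s)),
     brX r s (hX r s i) alpha x = \sum_(k < hdim r s) cg i alpha k *: hX r s k x)
  (gamma lambda : R -> 'rV[R]_(hdim r s))
  (hgamma : horizontal r s gamma) (hgamma0 : gamma 0 = 0)
  (hlambda : lipschitz01 lambda) :
  ((* (A) *)
   {ae (@lebesgue_measure R), forall t : R, 0 <= t <= 1 ->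
      derivable lambda t 1 /\ derivable gamma t 1 /\
      forall i : 'I_(hdim r s),
        ('D_1 lambda t) 0 i =
        - \sum_(k < hdim r s) \sum_(j < hdim r s | (j < r)%N)
            c i j k * ('D_1 gamma t) 0 j * lambda t 0 k}
   <->
   (* (B) *)
   exists v : 'rV[R]_(hdim r s),
     forall t : R, 0 <= t <= 1 -> forall i : 'I_(hdim r s),
       lambda t 0 i = extremalP r s cg v i (gamma t))
  /\
  (forall v : 'rV[R]_(hdim r s),
     (forall t : R, 0 <= t <= 1 -> forall i : 'I_(hdim r s),
        lambda t 0 i = extremalP r s cg v i (gamma t)) ->
     v = lambda 0).
Proof.
have s_gt0 : (0 < s)%N := ltnW hs.
pose I := index_enum 'I_(hdim r s); pose M x := Ad r s c I x; pose W x := AdV r s c I x.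
have WM x : W x *m M x = 1%:M by exact: AdVK.
have MW x : M x *m W x = 1%:M by exact: mulmx1C.
have PE v i x : extremalP r s cg v i x = (M x *m v^T) i 0 by exact: extremalPE.
have init v : (forall t : R, 0 <= t <= 1 -> forall i, lambda t 0 i =
    extremalP r s cg v i (gamma t)) -> v = lambda 0.
  move=> lv; apply/rowP => i; rewrite lv ?lexx ?ler01 // hgamma0 PE /M Ad0.
  by rewrite mul1mx mxE.
split; last exact: init.
have [lip_g [h [_ ae_g]]] := hgamma.
have dM t : derivable gamma t 1 ->
    'D_1 gamma t = \sum_(j < hdim r s | (j < r)%N) h j t *: hX r s j (gamma t) ->
    mxderiv (fun u => M (gamma u)) t (- (velocity r s c ('D_1 gamma t) *m M (gamma t))).
  by move=> dg Dg; exact: (Ad_curve_deriv _ _ s_gt0 _ hc _ (fun j => h j t)).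
have ae_filter : Filter (almost_everywhere (@lebesgue_measure R)).
  exact: (@ae_filter_ringOfSetsType _ _ R (@lebesgue_measure R)).
(* Used to discard the endpoints: (B) constrains lambda on [0, 1] only and says nothing about
   two-sided derivatives at 0 and 1. *)
have ae_neq (a : R) : {ae (@lebesgue_measure R), forall t : R, t <> a}.
  exists [set a]; split; [exact: measurable_set1|exact: lebesgue_measure_set1|].
  by move=> t /= /contrapT.
split=> [A|[v lv]].
- exists (lambda 0) => T T01 i; rewrite PE.
  pose K u := W (gamma u) *m (lambda u)^T.
  suff K0 u : 0 <= u <= 1 -> K u = (lambda 0)^T.
    by rewrite -(K0 T T01) /K mulmxA MW mul1mx mxE.
  move=> u01; apply/colP => k.
  have -> : (lambda 0)^T k 0 = K 0 k 0.
    have := WM 0; rewrite /K hgamma0 [M 0]Ad0 // => /eqP; rewrite mulmx1 => /eqP ->.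
    by rewrite mul1mx.
  have [L L0 lipK] : lip (fun u => K u k 0).
    apply: (mxlipM (fun u => W (gamma u)) (fun u => (lambda u)^T)).
      by apply: mxlip_AdV => j; exact: lipschitz01_coord.
    by move=> p q; rewrite (ord1 q); under eq_fun do rewrite mxE; exact: lipschitz01_coord.
  apply: (lipschitz_ae_derive0 (fun u => K u k 0) L L0 lipK) u01.
  apply: (@filterS2 _ _ ae_filter _ _ _ _ A ae_g) => t At gt /andP[t0 t1].
  have t01' : 0 <= t <= 1 by rewrite !ltW.
  have [dl [dg lamE]] := At t01'; have [_ Dg] := gt t01'.
  have [W' dW] := mxderiv_AdV r s s_gt0 c hc I gamma t
     (fun k => ex_intro _ _ (is_derive_row _ _ _ _ k dg)).
  have {}dM := dM t dg Dg; set G := velocity r s c ('D_1 gamma t) in dM.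
  (* The derivative of the inverse is found by differentiating W M = 1. *)
  have W'E : W' *m M (gamma t) = W (gamma t) *m (G *m M (gamma t)).
    have d1 := mxderivM _ _ _ _ _ dW dM.
    have : mxderiv (fun u => W (gamma u) *m M (gamma u)) t 0.
      by under eq_fun do rewrite WM; exact: mxderiv_cst.
    move=> d0; apply/eqP; rewrite -subr_eq0 -mulmxN; apply/eqP/matrixP => p q.
    by have [_ <-] := d1 p q; have [_ <-] := d0 p q.
  have {}W'E : W' = W (gamma t) *m G.
    by rewrite -[LHS]mulmx1 -(MW (gamma t)) mulmxA W'E -!mulmxA MW mulmx1.
  have dl' : mxderiv (fun u => (lambda u)^T) t (- (G *m (lambda t)^T)).
    move=> p q; rewrite (ord1 q) velocityE -lamE.
    by under eq_fun do rewrite mxE; exact: is_derive_row.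
  have := mxderivM _ _ _ _ _ dW dl'.
  rewrite W'E mulmxN mulmxA subrr => /(_ k 0).
  by rewrite mxE.
- apply: (@filterS3 _ _ ae_filter _ _ _ _ _ ae_g (ae_neq 0) (ae_neq 1)) => t gt tn0 tn1 t01.
  have t01' : 0 < t < 1.
    have /andP[t0 t1] := t01; rewrite !lt_neqAle t0 t1 !andbT eq_sym.
    by apply/andP; split; apply/eqP.
  have [dg Dg] := gt t01; have {}dM := dM t dg Dg.
  set G := velocity r s c ('D_1 gamma t) in dM.
  have dMv := mxderivM _ _ _ _ _ dM (mxderiv_cst v^T t).
  have dl i : is_derive t (1 : R) (fun u => lambda u 0 i) ((- (G *m (lambda t)^T)) i 0).
    have -> : - (G *m (lambda t)^T) = - (G *m M (gamma t)) *m v^T + M (gamma t) *m 0.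
      rewrite mulmx0 addr0 mulNmx -mulmxA; congr (- (_ *m _)).
      by apply/colP => p; rewrite mxE lv // PE.
    apply: near_eq_is_derive (dMv i 0).
    near=> u; rewrite lv ?PE //; apply/andP; split; apply: ltW; near: u.
    + by apply: lt_nbhsr; case/andP: t01'.
    + by apply: lt_nbhsl; case/andP: t01'.
  have dlam : derivable lambda t 1.
    apply/derivable_mxP => p q; rewrite (ord1 p); by have [] := dl q.
  split => //; split => // i.
  rewrite derive_mx // mxE -velocityE.
  by have [_] := dl i.
Unshelve. all: by end_near.
Qed.
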